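(* For all but a finite number of graphs $H$, every C46-problem is NP-complete on $H$-free graphs, $H$-contraction-free graphs, $H$-induced-minor-free graphs, and $H$-induced-topological-minor-free graphs. Moreover, in each of the open cases (the remaining graphs $H$), $H$ is a planar $sP_1$-free graph for some $s\geq 1$.
   Context: A graph $G=(V,E)$ has a vertex set $V$ and an edge set $E$ consisting of unordered pairs of vertices. A statement about a problem ''on'' (or ''for'') a graph class refers to the problem with input graphs restricted to that class. The independence number of a graph is the size of a largest independent set (set of pairwise non-adjacent vertices) in it. A class of graphs has bounded independence number if there exists a constant $c$ such that every graph in the class has independence number at most $c$. A problem $\Pi$ is a C46-problem if it satisfies both of the following conditions: C4: $\Pi$ is NP-complete for the class of planar graphs; C6: $\Pi$ is NP-complete for some class of graphs of bounded independence number. Graph operations. Vertex deletion (VD) deletes a vertex. Edge contraction (EC) of an edge $uv$ deletes $u$ and $v$ and replaces them by a new vertex made adjacent to precisely those vertices to which $u$ or $v$ were adjacent (without creating parallel edges). Vertex dissolution (VDi) can be applied only to a vertex $v$ of degree $2$ whose two neighbours are not adjacent, and contracts one of the two edges incident with $v$. A graph $G$ contains a graph $H$ as an induced subgraph, contraction, induced minor, or induced topological minor if $H$ can be obtained (up to isomorphism) from $G$ by a (possibly empty) sequence of operations from, respectively, {VD}; {EC, VDi}; {VD, EC, VDi}; {VD, VDi}. $G$ is $H$-free, $H$-contraction-free, $H$-induced-minor-free, or $H$-induced-topological-minor-free if it does not contain $H$ as, respectively, an induced subgraph, a contraction, an induced minor, or an induced topological minor. $sP_1$ denotes the graph consisting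 of $s$ isolated vertices.
   Formalization: The finite set of exceptional graphs H (and s) may depend on the C46-problem, since with one set for all problems the claim fails for every planar H (require G to contain H); NP-completeness on a class includes membership in NP on all graphs. *)

(* Defs.v *)
From HB Require Import structures.
From mathcomp Require Import all_boot all_order all_algebra.
From mathcomp Require Import reals.

Set Implicit Arguments.
Unset Strict Implicit.
Unset Printing Implicit Defensive.

Import GRing.Theory Num.Theory.

(** * Finite simple graphs *)

Record sgraph := SGraph {
  vertex :> finType;
  adj : rel vertex;
  adj_sym : symmetric adj;
  adj_irr : irreflexive adj
}.

Definition graph_class := sgraph -> Prop.

Definition isomorphic (G H : sgraph) : Prop :=
  exists2 f : G -> H, bijective f & forall x y : G, adj (f x) (f y) = adj x y.

Definition finite_up_to_iso (C : graph_class) : Prop :=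
  exists (k : nat) (F : 'I_k -> sgraph),
    forall H : sgraph, C H -> exists i : 'I_k, isomorphic H (F i).

Definition stable (G : sgraph) (S : {set G}) : bool :=
  [forall x in S, forall y in S, ~~ adj x y].

Definition independence_number (G : sgraph) : nat :=
  \max_(S : {set G} | stable S) #|S|.

Definition bounded_independence_number (C : graph_class) : Prop :=
  exists c : nat, forall G : sgraph, C G -> independence_number G <= c.

(* [edgeless s] is the graph sP_1. *)
Fact edgeless_sym s : symmetric (fun _ _ : 'I_s => false). Proof. by []. Qed.
Fact edgeless_irr s : irreflexive (fun _ _ : 'I_s => false). Proof. by []. Qed.
Definition edgeless (s : nat) : sgraph :=
  SGraph (@edgeless_sym s) (@edgeless_irr s).

(** * Graph operations and containment relations *)

Section Operations.
Variable G : sgraph.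

Definition del_rel (v : G) : rel {x : G | x != v} :=
  fun x y => adj (val x) (val y).
Fact del_sym v : symmetric (@del_rel v).
Proof. by move=> x y; rewrite /del_rel adj_sym. Qed.
Fact del_irr v : irreflexive (@del_rel v).
Proof. by move=> x; rewrite /del_rel adj_irr. Qed.
Definition del_vertex (v : G) : sgraph := SGraph (@del_sym v) (@del_irr v).

(* [None] is the new vertex replacing [u] and [v]. *)
Definition contract_rel (u v : G) :
    rel (option {x : G | (x != u) && (x != v)}) :=
  fun a b => match a, b with
    | None, None => false
    | Some x, Some y => adj (val x) (val y)
    | None, Some x | Some x, None => adj u (val x) || adj v (val x)
    end.
Fact contract_sym u v : symmetric (@contract_rel u v).
Proof. by move=> [x|] [y|] //=; rewrite adj_sym. Qed.
Fact contract_irr u v : irreflexive (@contract_rel u v).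
Proof. by move=> [x|] //=; rewrite adj_irr. Qed.
Definition contract (u v : G) : sgraph :=
  SGraph (@contract_sym u v) (@contract_irr u v).

End Operations.

(* Vertex deletion, edge contraction, vertex dissolution. *)
Inductive operation := VD | EC | VDi.

Inductive op_step : operation -> sgraph -> sgraph -> Prop :=
| StepVD (G : sgraph) (v : G) : op_step VD G (del_vertex v)
| StepEC (G : sgraph) (u v : G) : adj u v -> op_step EC G (contract u v)
| StepVDi (G : sgraph) (v u w : G) :
    u != w -> [set x | adj v x] = [set u; w] -> ~~ adj u w ->
    op_step VDi G (contract v u).

(* [obtained ops G H]: up to isomorphism, [H] results from [G] by a possibly
   empty sequence of operations among [ops]. *)
Inductive obtained (ops : operation -> Prop) : sgraph -> sgraph -> Prop :=
| ObtainedIso (G H : sgraph) : isomorphic G H -> obtained ops G H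
| ObtainedStep (o : operation) (G G' H : sgraph) :
    ops o -> op_step o G G' -> obtained ops G' H -> obtained ops G H.

Definition contains_induced_subgraph : sgraph -> sgraph -> Prop :=
  obtained (fun o => o = VD).
Definition contains_contraction : sgraph -> sgraph -> Prop :=
  obtained (fun o => o = EC \/ o = VDi).
Definition contains_induced_minor : sgraph -> sgraph -> Prop :=
  obtained (fun o => [\/ o = VD, o = EC | o = VDi]).
Definition contains_induced_topological_minor : sgraph -> sgraph -> Prop :=
  obtained (fun o => o = VD \/ o = VDi).

Definition induced_subgraph_free (H : sgraph) : graph_class :=
  fun G => ~ contains_induced_subgraph G H.
Definition contraction_free (H : sgraph) : graph_class :=
  fun G => ~ contains_contraction G H.
Definition induced_minor_free (H : sgraph) : graph_class :=
  fun G => ~ contains_induced_minor G H.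
Definition induced_topological_minor_free (H : sgraph) : graph_class :=
  fun G => ~ contains_induced_topological_minor G H.

(** * Planar graphs *)

(* A planar graph is one that can be drawn in the plane R^2 with edges drawn as
   arcs, an arc being a finite union of straight line segments homeomorphic to
   [0,1] (Diestel, "Graph Theory", Sections 4.1, 4.2 and 4.4). *)

Section Planar.
Local Open Scope ring_scope.
Variable R : realType.

Notation point := 'rV[R]_2.

Definition on_segment (a b x : point) : Prop :=
  exists2 t : R, 0 <= t <= 1 & x = (1 - t) *: a + t *: b.

Definition on_polyline (p : seq point) (x : point) : Prop :=
  exists2 i : nat, (i.+1 < size p)%N & on_segment p`_i p`_i.+1 x.

(* Two segments of the polyline meet only if they are consecutive, and then
   only in their shared corner. *)
Definition simple_polyline (p : seq point) : Prop :=
  forall (i j : nat) (x : point), (i < j)%N -> (j.+1 < size p)%N ->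
    on_segment p`_i p`_i.+1 x -> on_segment p`_j p`_j.+1 x ->
    j = i.+1 /\ x = p`_j.

Definition arc_between (a b : point) (p : seq point) : Prop :=
  [/\ (1 < size p)%N, head 0 p = a, last 0 p = b & simple_polyline p].

Definition planar (G : sgraph) : Prop :=
  exists (pos : G -> point) (arc : G -> G -> seq point),
    [/\ injective pos,
        forall u v : G, adj u v -> arc_between (pos u) (pos v) (arc u v),
        (* the arc depends only on the unordered pair *)
        forall u v : G, adj u v -> arc v u = rev (arc u v) &
        (* the interior of an edge contains no vertex and no point of any
           other edge *)
        forall (u v : G) (x : point), adj u v ->
          on_polyline (arc u v) x -> x <> pos u -> x <> pos v ->
          (forall w : G, x <> pos w) /\
          (forall u' v' : G, adj u' v' -> on_polyline (arc u' v') x ->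
             [set u'; v'] = [set u; v])].

End Planar.

(** * Polynomial time and NP *)

Inductive direction := MoveLeft | Stay | MoveRight.

(* Deterministic single-tape Turing machine.  A tape cell holds [None] (blank),
   [Some (inl b)] (a bit) or [Some (inr a)] (an auxiliary symbol); the machine
   halts when [trans] returns [None]. *)
Record tm := TM {
  state : finType;
  aux : finType;
  start : state;
  trans : state -> option (bool + aux) ->
          option (state * option (bool + aux) * direction)
}.

Section Run.
Variable M : tm.

Definition cell : Type := option (bool + aux M).

(* The tape is infinite in both directions: [left_of] lists the cells to the
   left of the head, nearest first, and all cells not listed are blank. *)
Record config := Config {
  cur_state : state M;
  left_of : seq cell;
  scanned : cell;
  right_of : seq cell
}.

Definition step (c : config) : option config :=
  let l := left_of c in
  let r := right_of c in
  match trans (cur_state c) (scanned c) with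
  | None => None
  | Some (q, a, MoveLeft) => Some (Config q (behead l) (head None l) (a :: r))
  | Some (q, a, Stay) => Some (Config q l a r)
  | Some (q, a, MoveRight) => Some (Config q (a :: l) (head None r) (behead r))
  end.

Definition init (w : bitseq) : config :=
  let tape : seq cell := [seq Some (inl b) | b <- w] in
  Config (start M) [::] (head None tape) (behead tape).

Fixpoint read_bits (s : seq cell) : bitseq :=
  if s is Some (inl b) :: s' then b :: read_bits s' else [::].

(* The output is the maximal block of bits starting at the head. *)
Definition output (c : config) : bitseq := read_bits (scanned c :: right_of c).

Definition outputs_within (t : nat) (w z : bitseq) : Prop :=
  exists (i : nat) (c : config),
    [/\ i <= t, iter i (obind step) (Some (init w)) = Some c,
        step c = None & output c = z].

End Run.

(* The bounds n ^ k + k are cofinal among the polynomials in n. *)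
Definition polytime (f : bitseq -> bitseq) : Prop :=
  exists (M : tm) (k : nat),
    forall w : bitseq, outputs_within M (size w ^ k + k) w (f w).

Definition polytime_decidable (b : pred bitseq) : Prop :=
  polytime (fun w => [:: b w]).

Definition language := bitseq -> Prop.

(* Self-delimiting pairing: each bit of [x] is preceded by [true], and [false]
   marks the end of [x]. *)
Definition pair_bits (x y : bitseq) : bitseq :=
  flatten [seq [:: true; b] | b <- x] ++ false :: y.

Definition in_NP (L : language) : Prop :=
  exists (verifier : pred bitseq) (k : nat),
    polytime_decidable verifier /\
    forall x : bitseq,
      L x <-> exists2 y : bitseq, size y <= size x ^ k + k &
                                  verifier (pair_bits x y).

(** * Problems on graph classes *)

(* An instance is a graph on {0, ..., n-1} together with further input data
   (an integer, a list of terminals, ...), possibly irrelevant. *)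
Record instance := Instance {
  inst_order : nat;
  inst_adj : rel 'I_inst_order;
  inst_sym : symmetric inst_adj;
  inst_irr : irreflexive inst_adj;
  inst_data : bitseq
}.

Definition inst_graph (I : instance) : sgraph :=
  SGraph (@inst_sym I) (@inst_irr I).

(* The order in unary, the adjacency matrix row by row, then the data. *)
Definition encode (I : instance) : bitseq :=
  nseq (inst_order I) true ++ false ::
  [seq inst_adj i j | i <- enum 'I_(inst_order I), j <- enum 'I_(inst_order I)]
  ++ inst_data I.

Definition problem := instance -> Prop.

Definition language_of (Pi : problem) : language :=
  fun w => exists2 I : instance, w = encode I & Pi I.

Definition NP_hard_on (Pi : problem) (C : graph_class) : Prop :=
  forall L : language, in_NP L ->
    exists2 f : bitseq -> bitseq, polytime f &
      forall w : bitseq, exists I : instance,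
        [/\ f w = encode I, C (inst_graph I) & L w <-> Pi I].

(* Restricting the inputs to [C] is a promise: [C] itself need not be
   recognisable in polynomial time, and "NP-complete on [C]" means that [Pi] is
   a problem in NP that stays NP-hard when all input graphs are in [C]. *)
Definition NP_complete_on (Pi : problem) (C : graph_class) : Prop :=
  in_NP (language_of Pi) /\ NP_hard_on Pi C.

Definition C46_problem (R : realType) (Pi : problem) : Prop :=
  NP_complete_on Pi (planar R) /\
  exists2 C : graph_class,
    bounded_independence_number C & NP_complete_on Pi C.

(* Main.v *)
(** Let c bound the independence numbers of the second class of a C46-problem.
    The open cases are the planar graphs H with independence number at most c.
    Independence number and planarity pass to every graph obtained by the
    operations, so a nonplanar H is contained in no planar graph and an H of
    independence number above c in no graph of the second class.  By Ramsey's
    theorem a large graph of independence number at most c contains K5, so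
    finitely many open cases remain once K5 is known to be nonplanar.

    K5 is nonplanar: for two disjoint polygonal arcs, the parity of the number
    of pairs of an end of one arc and a segment of the other above it is
    determined by the order of the four ends along a generic axis.  By additivity this is a
    statement on two segments; summed over the 15 pairs of disjoint edges of K5
    it gives 1 = 0 mod 2.

    Planarity is closed under contraction: view a drawing as a system of paths
    in a straight-line plane graph and contract the first segment [a,b] of the
    arc of uv.  A thin convex neighbourhood N of [a,b] meets the drawing only in
    radial pieces of the segments at a and at b, so the former may be replaced
    by the straight segments from b to the points where they leave N.  Repeating
    this moves u along the arc until it reaches v. *)

Require Import Defs.
From mathcomp Require Import boolp topology normedtype derive.
From mathcomp Require Import all_boot all_order all_algebra.
From mathcomp Require Import reals.
From mathcomp Require Import zify ring lra.
From Stdlib Require Import Btauto.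

Set Implicit Arguments.
Unset Strict Implicit.
Unset Printing Implicit Defensive.

Import Order.TTheory GRing.Theory Num.Theory.
Import numFieldNormedType.Exports.

(** The tactic [btauto] reifies [xorb], so the parity identities below are first brought into that
    form. *)
Lemma addbE b1 b2 : b1 (+) b2 = xorb b1 b2.
Proof. by case: b1; case: b2. Qed.

Lemma addb_eq b1 b2 : b1 (+) b2 = false -> b1 = b2.
Proof. by case: b1; case: b2. Qed.

Lemma adj_neq (G : sgraph) (x y : G) : adj x y -> x != y.
Proof. by apply: contraTneq => ->; rewrite adj_irr. Qed.

(** * Points on segments and polylines *)

Section Segments.
Variable R : realType.
Local Notation point := 'rV[R]_2.
Local Notation seg := (@on_segment R).
Local Open Scope ring_scope.

Lemma seg_sym (x y p : point) : seg x y p -> seg y x p.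
Proof.
case=> t /andP[t0 t1] ->; exists (1 - t); last by rewrite opprB addrC subrKC.
by apply/andP; split; lra.
Qed.

Lemma seg_end (x y p : point) : p \in [:: x; y] -> seg x y p.
Proof.
rewrite !inE => /orP[]/eqP->.
  by exists 0; rewrite ?lexx ?ler01 // subr0 scale1r scale0r addr0.
by exists 1; rewrite ?lexx ?ler01 // subrr scale1r scale0r add0r.
Qed.

Lemma on_polyline_cons (a b : point) p x :
  on_polyline (a :: b :: p) x <-> on_segment a b x \/ on_polyline (b :: p) x.
Proof.
split=> [[[|i] /= hi hx]|[hx|[i hi hx]]]; first by left.
- by right; exists i.
- by exists 0.
- by exists i.+1.
Qed.

Lemma mem_polyline (p : seq point) x :
  (1 < size p)%N -> x \in p -> on_polyline p x.
Proof.
case: p => [|a [|b p]] // _; elim: p a b => [|c p IH] a b.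
  by move=> h; apply/on_polyline_cons; left; apply: seg_end.
rewrite in_cons => /orP[/eqP->|/IH h]; apply/on_polyline_cons; last by right.
by left; apply: seg_end; rewrite mem_head.
Qed.

End Segments.

(** * Nonplanarity of the complete graph on five vertices *)

Section Crossing.
Local Open Scope ring_scope.
Variable R : realType.
Local Notation point := 'rV[R]_2.

(* A generic axis: for a suitable slope [d] no two of finitely many given points
   have the same [shear]. *)
Variable d : R.
Definition shear (p : point) : R := p 0 0 + d * p 0 1.
Definition height (p q : point) (x : R) : R :=
  p 0 1 + (x - shear p) * ((q 0 1 - p 0 1) / (shear q - shear p)).
Definition between (p q r : point) : bool :=
  (shear p < shear r) (+) (shear q < shear r).
(* When [shear p = shear q] the division in [height] yields a junk value, but then
   [between p q r] is false. *)
Definition above (p q r : point) : bool :=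
  between p q r && (r 0 1 < height p q (shear r)).

Lemma heightC p q x : shear p != shear q -> height p q x = height q p x.
Proof.
move=> pq; rewrite /height; have h1 : shear q - shear p != 0 by rewrite subr_eq0 eq_sym.
have h2 : shear p - shear q != 0 by rewrite subr_eq0.
by field; rewrite h1 h2.
Qed.

Lemma aboveC p q r : above p q r = above q p r.
Proof.
rewrite /above /between addbC.
by case: (shear p =P shear q) => [->|/eqP h]; [rewrite addbb | rewrite heightC].
Qed.

Lemma on_height p q x : shear p < shear q -> shear p <= x <= shear q ->
  exists2 z, on_segment p q z & shear z = x /\ z 0 1 = height p q x.
Proof.
move=> pq /andP[h1 h2].
have h0 : 0 < shear q - shear p by rewrite subr_gt0.
exists ((1 - (x - shear p) / (shear q - shear p)) *: p
        + ((x - shear p) / (shear q - shear p)) *: q).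
  exists ((x - shear p) / (shear q - shear p)) => //.
  by rewrite ler_pdivlMr // mul0r subr_ge0 h1 ler_pdivrMr // mul1r lerD2r.
have hn : shear q - shear p != 0 by rewrite gt_eqF.
split; last by rewrite /height !mxE; field.
move: hn; rewrite /shear !mxE => hn; field; exact: hn.
Qed.

Lemma shear_inj z z' : shear z = shear z' -> z 0 1 = z' 0 1 -> z = z'.
Proof.
rewrite /shear => h1 h2; rewrite h2 in h1; move/addIr: h1 => h1.
apply/rowP => i; case: (unliftP 0 i) => [j|] -> //; rewrite [j]ord1.
by have -> : lift 0 0 = 1 :> 'I_2 by apply/val_inj.
Qed.

(* The difference of two heights is affine in the abscissa, so it vanishes
   between two abscissas at which it has opposite signs. *)
Lemma height_cross p q r s x y : shear p < shear q -> shear r < shear s ->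
  x <= y -> shear p <= x -> y <= shear q -> shear r <= x -> y <= shear s ->
  (height p q x - height r s x) * (height p q y - height r s y) <= 0 ->
  exists2 z, on_segment p q z & on_segment r s z.
Proof.
move=> pq rs xy px yq rx ys hxy.
suff [w /andP[xw wy] hw] : exists2 w, x <= w <= y & height p q w = height r s w.
  have [|z1 s1 [a1 b1]] := @on_height p q w pq.
    by rewrite (le_trans px xw) (le_trans wy yq).
  have [|z2 s2 [a2 b2]] := @on_height r s w rs.
    by rewrite (le_trans rx xw) (le_trans wy ys).
  exists z1 => //; rewrite (@shear_inj z1 z2) ?a1 ?a2 ?b1 ?b2 //.
move: hxy; set g := height p q x - _; set g' := height p q y - _ => hgg.
have [E|E] := eqVneq g g'.
  exists x; first by rewrite lexx xy.
  apply/eqP; rewrite -subr_eq0 -/g; rewrite -E in hgg; nra.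
have Egg : g - g' != 0 by rewrite subr_eq0.
(* The root of the affine function that takes the value [g] at [x] and [g'] at [y]. *)
exists (x + g / (g - g') * (y - x)).
  suff /andP[h1 h2] : 0 <= g / (g - g') <= 1 by nra.
  have [h|h] := ltP 0 (g - g').
    have ? : 0 <= g by nra.
    have ? : g' <= 0 by nra.
    by apply/andP; split; [rewrite ler_pdivlMr // mul0r|rewrite ler_pdivrMr //; lra].
  have {}h : g - g' < 0 by rewrite lt_neqAle Egg.
  have ? : g <= 0 by nra.
  have ? : 0 <= g' by nra.
  by apply/andP; split; [rewrite ler_ndivlMr // mul0r|rewrite ler_ndivrMr //; lra].
apply/eqP; rewrite -subr_eq0; apply/eqP.
set k := g / _.
have -> : height p q (x + k * (y - x)) - height r s (x + k * (y - x)) =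
  g + k * (g' - g) by rewrite /g /g' /height; ring.
by rewrite /k; field.
Qed.

Definition interleave (p q r s : point) : bool :=
  between p q r (+) between p q s.

(** The [above] terms count the ends of one segment lying below the other; [interleave] is the value
    of this count modulo 2 that the order of the four abscissas predicts for disjoint segments. *)
Definition parity_sum (p q r s : point) : bool :=
  above p q r (+) above p q s (+) (above r s p (+) above r s q)
  (+) interleave p q r s.

Definition generic (p q r s : point) :=
  [/\ shear p != shear r, shear p != shear s, shear q != shear r
    & shear q != shear s].

Lemma betweenC p q r : between p q r = between q p r.
Proof. exact: addbC. Qed.

Lemma parity_sumC p q r s : parity_sum p q r s = parity_sum q p r s.
Proof.
rewrite /parity_sum /interleave !(aboveC p q) !(betweenC p q).
by congr (_ (+) _ (+) _); rewrite addbC.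
Qed.

Lemma parity_sumC2 p q r s : parity_sum p q r s = parity_sum p q s r.
Proof.
rewrite /parity_sum /interleave !(aboveC r s).
by congr (_ (+) _ (+) _); rewrite addbC.
Qed.

Lemma interleave_sym p q r s : generic p q r s ->
  interleave p q r s = interleave r s p q.
Proof.
case=> pr ps qr qs; rewrite /interleave /between.
have N x y : shear x != shear y -> (shear y < shear x) = ~~ (shear x < shear y).
  by move=> xy; rewrite -leNgt le_eqVlt eq_sym (negbTE xy).
rewrite (N _ _ pr) (N _ _ ps) (N _ _ qr) (N _ _ qs).
by do 4!case: (_ < _).
Qed.

Lemma parity_sum_sym p q r s : generic p q r s ->
  parity_sum p q r s = parity_sum r s p q.
Proof.
move=> g; rewrite /parity_sum interleave_sym //.
by congr (_ (+) _); rewrite addbC.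
Qed.

(** Segments reduced to a point are settled first: their terms vanish or cancel. Otherwise, by
    symmetry, [p] is leftmost and [r] is left of [s]. If the projections to the axis are disjoint,
    every term is false. If they are nested or overlap, the two segments keep the same vertical
    order at both ends of the common interval, since a change would give a common point by
    [height_cross]; the two remaining [above] terms are then equal in the nested case and opposite
    in the overlapping one. *)
Lemma parity_sum0 p q r s : generic p q r s ->
  (shear p = shear q -> p = q) -> (shear r = shear s -> r = s) ->
  (forall z, on_segment p q z -> on_segment r s z -> False) ->
  parity_sum p q r s = false.
Proof.
move=> g Ipq Irs.
have nbt a b : between a a b = false by rewrite /between addbb.
have [E|] := eqVneq (shear p) (shear q).
  by rewrite (Ipq E) /parity_sum /interleave /above !nbt /= addbb.
have [E|] := eqVneq (shear r) (shear s).
  by rewrite (Irs E) /parity_sum /interleave /above !nbt !addbb.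
move: g {Ipq Irs}.
wlog pq : p q / shear p < shear q.
  move=> W g rs pq D; move: (pq); rewrite neq_lt => /orP[] h; first exact: W.
  rewrite parity_sumC; apply: W => //; rewrite 1?eq_sym //; first by case: g.
  by move=> z /seg_sym; apply: D.
wlog rs : r s / shear r < shear s.
  move=> W g rs pq' D; move: (rs); rewrite neq_lt => /orP[] h; first exact: W.
  rewrite parity_sumC2; apply: W => //; rewrite 1?eq_sym //; first by case: g.
  by move=> z hz /seg_sym; apply: D.
wlog pr : p q r s pq rs / shear p < shear r.
  move=> W g n1 n2 D.
  have [prn _ _ _] := g; move: prn; rewrite neq_lt => /orP[] h; first exact: W.
  rewrite parity_sum_sym //; apply: W => //.
    by case: g => *; split; rewrite eq_sym.
  by move=> z hz hz'; exact: D hz' hz.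
case=> _ _ qr qs _ _ D.
have ps : shear p < shear s by apply: lt_trans rs.
have [qr'|rq] := ltP (shear q) (shear r).
  have qs' := lt_trans qr' rs.
  rewrite /parity_sum /above /interleave /between pr ps qr' qs'.
  by rewrite ![_ < shear p]ltNge !(ltW pr, ltW ps) ![_ < shear q]ltNge !(ltW qr', ltW qs').
have {qr rq}rq : shear r < shear q by rewrite lt_neqAle eq_sym qr.
have E1 : height r s (shear r) = r 0 1 by rewrite /height subrr mul0r addr0.
have E2 : height r s (shear s) = s 0 1 by rewrite /height; field; lra.
have E3 : height p q (shear q) = q 0 1 by rewrite /height; field; lra.
have H (a b c e : R) : (a - b) * (c - e) <= 0 \/ (b < a) = (e < c).
  have [h|h] := ltP b a; have [h'|h'] := ltP e c; try by [right]; left; nra.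
have [sq|qs'] := ltP (shear s) (shear q).
  rewrite /parity_sum /above /interleave /between pr ps.
  rewrite ![shear q < _]ltNge (ltW rq) (ltW sq) /=.
  rewrite ![_ < shear p]ltNge (ltW pr) (ltW ps) rq sq /= !addbF.
  have [h|->] := H (height p q (shear r)) (r 0 1) (height p q (shear s)) (s 0 1);
    last by rewrite addbb.
  have := height_cross pq rs (ltW rs) (ltW pr) (ltW sq) (lexx _) (lexx _).
  rewrite E1 E2 => /(_ h) [z z1 z2].
  by have := D _ z1 z2.
have {qs qs'}qs : shear q < shear s by rewrite lt_neqAle qs.
rewrite /parity_sum /above /interleave /between pr ps.
rewrite ![shear q < _]ltNge (ltW rq) leNgt qs /=.
rewrite ![_ < shear p]ltNge (ltW pr) (ltW ps) rq /= [_ < shear q]ltNge (ltW qs) /= !addbF.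
have nlt (x y : R) : x = y \/ (x < y) = ~~ (y < x).
  by have [|h|->] := ltgtP x y; [right|right|left].
have [h|->] := H (height p q (shear r)) (r 0 1) (q 0 1) (height r s (shear q)).
  have := height_cross pq rs (ltW rq) (ltW pr) (lexx _) (lexx _) (ltW qs).
  rewrite E1 E3 => /(_ h) [z z1 z2].
  by have := D _ z1 z2.
(* A tie of heights at [shear q] is a crossing too, namely at [q]. *)
have [E|->] := nlt (height r s (shear q)) (q 0 1); last by case: (_ < _).
have h : (height p q (shear q) - height r s (shear q)) *
         (height p q (shear q) - height r s (shear q)) <= 0.
  by rewrite E3 E subrr mulr0.
have [z z1 z2] := height_cross pq rs (lexx _) (ltW pq) (lexx _) (ltW rq) (ltW qs) h.
by have := D _ z1 z2.
Qed.

Fixpoint above_chain (p : point) (P : seq point) (r : point) : bool :=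
  if P is q :: P' then above p q r (+) above_chain q P' r else false.

(** Induction along the chain, each segment contributing one instance of [parity_sum0]. The terms of
    an inner corner [s] occur in two consecutive instances and cancel, in [interleave] as well. *)
Lemma segment_chain_parity p q r Q :
  {in p :: q :: r :: Q &, injective shear} ->
  p \notin r :: Q -> q \notin r :: Q ->
  (forall z, on_segment p q z -> on_polyline (r :: Q) z -> False) ->
  above p q r (+) above p q (last r Q)
  (+) (above_chain r Q p (+) above_chain r Q q)
  (+) interleave p q r (last r Q) = false.
Proof.
elim: Q r => [|s Q IH] r inj pn qn D /=.
  by rewrite /interleave !addbb.
have E : parity_sum p q r s = false.
  have neq x y : x \in [:: p; q] -> x \notin r :: s :: Q -> y \in [:: r; s] ->
      shear x != shear y.
    move=> xi xn yi; apply/eqP => /inj xy; move/negP: xn; apply.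
    have yi' : y \in r :: s :: Q.
      by move: yi; rewrite !inE => /orP[] ->; rewrite ?orbT.
    rewrite xy // in_cons; last by rewrite in_cons yi' !orbT.
    by move: xi; rewrite !inE => /orP[] ->; rewrite ?orbT.
  apply: parity_sum0.
  - by split; apply: neq; rewrite ?inE ?eqxx ?orbT.
  - by apply: inj; rewrite !inE eqxx ?orbT.
  - by apply: inj; rewrite !inE eqxx ?orbT.
  by move=> z z1 z2; apply: D z1 _; apply/on_polyline_cons; left.
have {IH}E' : _ = false := IH s _ _ _ _.
rewrite -[RHS]/(false (+) false) -{1}E -E'.
- rewrite /parity_sum /interleave.
  by rewrite /= !addbE; btauto.
- apply: sub_in2 inj => x; rewrite !inE.
  by case/or4P => ->; rewrite ?orbT.
- by move: pn; rewrite inE negb_or => /andP[].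
- by move: qn; rewrite inE negb_or => /andP[].
by move=> z z1 z2; apply: D z1 _; apply/on_polyline_cons; right.
Qed.

(** The same telescoping along the other chain, now with [segment_chain_parity] as the contribution
    of each segment. *)
Lemma chain_parity p P r Q :
  {in p :: P ++ r :: Q &, injective shear} ->
  {in p :: P, forall x, x \notin r :: Q} ->
  (forall z, on_polyline (p :: P) z -> on_polyline (r :: Q) z -> False) ->
  above_chain p P r (+) above_chain p P (last r Q)
  (+) (above_chain r Q p (+) above_chain r Q (last p P))
  (+) interleave p (last p P) r (last r Q) = false.
Proof.
elim: P p => [|q P IH] p inj pn D.
  by rewrite /interleave /between !addbb.
have E : _ = false := @segment_chain_parity p q r Q _ _ _ _.
have {IH}E' : _ = false := IH q _ _ _.
rewrite -[RHS]/(false (+) false) -{1}E -?E'.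
- by rewrite /interleave /between /= !addbE; btauto.
- by apply: sub_in2 inj => x xi; rewrite inE xi orbT.
- by move=> x xi; apply: pn; rewrite inE xi orbT.
- by move=> z z1; apply: D; apply/on_polyline_cons; right.
- apply: sub_in2 inj => x; rewrite !(inE, mem_cat).
  by case/or4P => ->; rewrite ?orbT.
- by apply: pn; rewrite inE eqxx.
- by apply: pn; rewrite !inE eqxx orbT.
by move=> z z1; apply: D; apply/on_polyline_cons; left.
Qed.

End Crossing.

Section GenericShear.
Local Open Scope ring_scope.

(** Distinct points of equal shear differ in the second coordinate, and the quotient of their
    coordinate differences is [-d]. Taking [d] larger than the sum of the absolute values of all
    such quotients excludes this. *)
Lemma exists_generic_shear (R : realType) (S : seq 'rV[R]_2) :
  exists d : R, {in S &, injective (shear d)}.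
Proof.
pose slope (c : 'rV[R]_2 * 'rV[R]_2) : R := `|(c.1 0 0 - c.2 0 0) / (c.1 0 1 - c.2 0 1)|.
exists (1 + \sum_(c <- [seq (x, y) | x <- S, y <- S]) slope c) => x y xS yS xy.
apply: (shear_inj xy); apply/eqP; rewrite -subr_eq0; apply/negPn/negP => nz.
have h : slope (x, y) <= \sum_(c <- [seq (x, y) | x <- S, y <- S]) slope c.
  rewrite (big_rem (x, y)) /=; last exact: allpairs_f.
  by rewrite lerDl sumr_ge0 // => c _; rewrite normr_ge0.
move: xy h; set D := \sum_(_ <- _) _; rewrite /shear => xy h.
have E : (x 0 0 - y 0 0) / (x 0 1 - y 0 1) = - (1 + D).
  apply: (mulIf nz); rewrite mulfVK //.
  lra.
have D0 : 0 <= D by apply: le_trans h; rewrite normr_ge0.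
by move: h; rewrite /slope /= E normrN ger0_norm; lra.
Qed.

End GenericShear.

Section K5.
Local Open Scope ring_scope.
Variables (R : realType) (G : sgraph) (f : 'I_5 -> G).
Hypotheses (f_inj : injective f) (f_adj : forall i j, i != j -> adj (f i) (f j)).

Lemma planar_no_K5 : ~ planar R G.
Proof.
case=> pos [arc [pos_inj arcP arcC arcD]].
(* The axis is generic for the corners of all arcs at once, so a single order [L] of the vertices
   serves all pairs of edges. *)
have [d inj] := exists_generic_shear (flatten [seq arc u v | u <- enum G, v <- enum G]).
pose B i j k := above_chain d (pos (f i)) (behead (arc (f i) (f j))) (pos (f k)).
pose L i j := shear d (pos (f i)) < shear d (pos (f j)).
have E i j k l : uniq [:: i; j; k; l] ->
  B i j k (+) B i j l (+) (B k l i (+) B k l j)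
  (+) (L i k (+) L j k (+) (L i l (+) L j l)) = false.
  have ends x y : x != y ->
      exists P, arc (f x) (f y) = pos (f x) :: P /\ last (pos (f x)) P = pos (f y).
    move=> xy; have [] := arcP _ _ (f_adj xy).
    by case: (arc _ _) => //= p P _ -> <- _; exists P.
  rewrite /= !inE !negb_or => /and4P[/and3P[ij ik il] /andP[jk jl] kl _].
  have [P [aP lP]] := ends i j ij; have [Q [aQ lQ]] := ends k l kl.
  have dj z : on_polyline (arc (f i) (f j)) z ->
      on_polyline (arc (f k) (f l)) z -> False.
    have neq x y : x != y -> pos (f x) <> pos (f y).
      by move=> xy /pos_inj /f_inj E; rewrite E eqxx in xy.
    have nend x y w : x != y -> w != x -> w != y ->
        on_polyline (arc (f x) (f y)) (pos (f w)) -> False.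
      move=> xy wx wy /(arcD _ _ _ (f_adj xy)) [||/(_ (f w))] //; exact: neq.
    move=> zij zkl.
    have [zi|/eqP zi] := eqVneq z (pos (f i)); first by subst z; exact: nend zkl.
    have [zj|/eqP zj] := eqVneq z (pos (f j)); first by subst z; exact: nend zkl.
    have [_ /(_ _ _ (f_adj kl) zkl) /setP /(_ (f k))] := arcD _ _ _ (f_adj ij) zij zi zj.
    by rewrite !inE eqxx !(inj_eq f_inj) ![k == _]eq_sym (negbTE ik) (negbTE jk).
  have := @chain_parity R d (pos (f i)) P (pos (f k)) Q _ _ _.
  rewrite lP lQ /B aP aQ /L /interleave /between /=; apply.
  - apply: sub_in2 inj => x; rewrite -cat_cons -aP -aQ mem_cat => xi; apply/flattenP.
    case/orP: xi => xi; [exists (arc (f i) (f j))|exists (arc (f k) (f l))] => //;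
      by apply: allpairs_f; rewrite mem_enum.
  - move=> x; rewrite -aP -aQ => xi; apply/negP => xk.
    apply: (dj x); apply: mem_polyline => //.
      by have [] := arcP _ _ (f_adj ij).
    by have [] := arcP _ _ (f_adj kl).
  - by rewrite -aP -aQ.
have N i j : i != j -> L j i = ~~ L i j.
  move=> ij; rewrite /L -leNgt le_eqVlt; case: eqP => //= Eij.
  have mem_arc x y : x != y -> pos (f x) \in flatten [seq arc u v | u <- enum G, v <- enum G].
    move=> xy; apply/flattenP; exists (arc (f x) (f y)).
      by apply: allpairs_f; rewrite mem_enum.
    have [] := arcP _ _ (f_adj xy).
    by case: (arc _ _) => //= a p _ <- _ _; rewrite inE eqxx.
  have := inj _ _ (mem_arc _ _ ij) (mem_arc j i _) (esym Eij).
  rewrite eq_sym => /(_ ij) /pos_inj /f_inj Ei.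
  by rewrite Ei eqxx in ij.
pose o (n : nat) : 'I_5 := inord n.
have E' i j k l : uniq [:: i; j; k; l] -> all (fun n => n < 5)%N [:: i; j; k; l] ->
   B (o i) (o j) (o k) (+) B (o i) (o j) (o l)
  (+) (B (o k) (o l) (o i) (+) B (o k) (o l) (o j))
  (+) (L (o i) (o k) (+) L (o j) (o k) (+) (L (o i) (o l) (+) L (o j) (o l))) = false.
  move=> u /allP h; apply: E; rewrite -[_ :: _]/(map o [:: i; j; k; l]) map_inj_in_uniq //.
  by move=> x y /h xl /h yl /(congr1 val); rewrite /= !inordK.
have N' i j : (j < i < 5)%N -> L (o i) (o j) = ~~ L (o j) (o i).
  case/andP=> h1 h2; apply: N; apply/eqP => /(congr1 val).
  rewrite /= !inordK // ?(ltn_trans h1) // => e; by rewrite e ltnn in h1.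
(* Over four vertices the interleavings of the three pairs of disjoint edges sum
   to 1; each [B] occurs for exactly two of the five quadruples. *)
have E4 i j k l : uniq [:: i; j; k; l] -> all (fun n => n < 5)%N [:: i; j; k; l] ->
    (i < j < k)%N && (k < l)%N -> true =
    (B (o i) (o j) (o k) (+) B (o i) (o j) (o l) (+)
      (B (o k) (o l) (o i) (+) B (o k) (o l) (o j)))
    (+) (B (o i) (o k) (o j) (+) B (o i) (o k) (o l) (+)
      (B (o j) (o l) (o i) (+) B (o j) (o l) (o k)))
    (+) (B (o i) (o l) (o j) (+) B (o i) (o l) (o k) (+)
      (B (o j) (o k) (o i) (+) B (o j) (o k) (o l))).
  move=> u a; case/andP=> /andP[ij jk] kl.
  have p (x y z w : nat) : perm_eq [:: i; j; k; l] [:: x; y; z; w] ->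
      B (o x) (o y) (o z) (+) B (o x) (o y) (o w) (+)
      (B (o z) (o w) (o x) (+) B (o z) (o w) (o y))
      = L (o x) (o z) (+) L (o y) (o z) (+) (L (o x) (o w) (+) L (o y) (o w)).
    move=> xy; apply: addb_eq; apply: E'; first by rewrite -(perm_uniq xy).
    by rewrite -(perm_all _ xy).
  rewrite (p i j k l) // (p i k j l); last by apply/permP => q /=; lia.
  rewrite (p i l j k); last by apply/permP => q /=; lia.
  move: a => /= /and5P[_ j5 k5 l5 _].
  rewrite (N' k j) ?jk ?k5 // (N' l j) ?(ltn_trans jk kl) ?l5 // (N' l k) ?kl ?l5 //.
  by do 6!case: (L _ _).
(* The five sets of four vertices; as five is odd, their left-hand sides add up to [true]. *)
have T := congr2 addb (E4 0 1 2 3 isT isT isT)%N (congr2 addb (E4 0 1 2 4 isT isT isT)%N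
  (congr2 addb (E4 0 1 3 4 isT isT isT)%N (congr2 addb (E4 0 2 3 4 isT isT isT)%N
  (E4 1 2 3 4 isT isT isT)%N))).
suff: true = false by [].
rewrite -[LHS]/(addb true (addb true (addb true (addb true true)))) T.
rewrite !addbE.
by btauto.
Qed.
End K5.

(** * Contraction of a segment of a straight-line plane graph *)

Section Gauge.
Local Open Scope ring_scope.
Variable R : realType.
Local Notation point := 'rV[R]_2.
Local Notation seg := (@on_segment R).

(** Both [y] and [y'] lie on the ray from [b] through [p]; the one with the larger parameter for [p]
    is the nearer to [b]. *)
Lemma seg_collinear (b y y' p : point) :
  seg b y p -> seg b y' p -> p != b -> seg b y y' \/ seg b y' y.
Proof.
wlog suff W : y y' / forall k k', 0 <= k -> k <= k' -> k' <= 1 ->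
    p = (1 - k) *: b + k *: y -> p = (1 - k') *: b + k' *: y' -> p != b -> seg b y y'.
  case=> k /andP[k0 k1] pk [k' /andP[k0' k1'] pk'] pb.
  have [h|/ltW h] := leP k k'; first by left; apply: (W y y' k k').
  by right; apply: (W y' y k' k).
move=> k k' k0 kk k1 e1 e2 pb.
have kn : 0 < k'.
  rewrite lt_neqAle eq_sym (le_trans k0 kk) andbT; apply: contra_neq pb => k'0.
  by rewrite e2 k'0 subr0 scale1r scale0r addr0.
exists (k / k').
  by rewrite ler_pdivlMr // mul0r k0 ler_pdivrMr // mul1r.
apply/rowP => i; have := congr1 (fun v : point => v 0 i) e1.
rewrite e2 !mxE => h.
have kn' : k' != 0 by rewrite gt_eqF.
apply: (mulfI kn').
have -> : k' * ((1 - k / k') * b 0 i + k / k' * y 0 i) = (k' - k) * b 0 i + k * y 0 i.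
  by field.
lra.
Qed.

Definition convex_along (g : point -> R) := forall x y k, 0 <= k <= 1 ->
  g ((1 - k) *: x + k *: y) <= (1 - k) * g x + k * g y.

(** The sublevel sets [{g <= eps}] serve as the thin convex neighbourhoods of [[a,b]]. Continuity is
    stated along lines, which is all that the extreme and intermediate value theorems below
    require. *)
Lemma exists_gauge (a b : point) : a != b -> exists g : point -> R,
  [/\ forall x, 0 <= g x, forall x, g x <= 0 -> seg a b x, g a = 0 /\ g b = 0,
      convex_along g &
      forall x y : point, continuous (fun k : R => g ((1 - k) *: x + k *: y))].
Proof.
move=> ab.
pose n : R := (b 0 0 - a 0 0) ^+ 2 + (b 0 1 - a 0 1) ^+ 2.
have n0 : n != 0.
  apply: contra_neq ab => /eqP; rewrite paddr_eq0 ?sqr_ge0 // !sqrf_eq0 !subr_eq0.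
  case/andP => /eqP h1 /eqP h2; apply/rowP => i.
  case: (unliftP 0 i) => [j|] -> //; rewrite [j]ord1.
  by have -> : lift 0 0 = 1 :> 'I_2 by apply/val_inj.
(* Coordinates along and across [a,b]; the gauge is |t| + |s| + |1 - s| - 1. *)
pose s (x : point) : R :=
  ((x 0 0 - a 0 0) * (b 0 0 - a 0 0) + (x 0 1 - a 0 1) * (b 0 1 - a 0 1)) / n.
pose t (x : point) : R :=
  ((x 0 0 - a 0 0) * (b 0 1 - a 0 1) - (x 0 1 - a 0 1) * (b 0 0 - a 0 0)) / n.
have sE x y k : s ((1 - k) *: x + k *: y) = (1 - k) * s x + k * s y.
  by rewrite /s !mxE; field.
have tE x y k : t ((1 - k) *: x + k *: y) = (1 - k) * t x + k * t y.
  by rewrite /t !mxE; field.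
have sa : s a = 0 by rewrite /s !subrr !mul0r addr0 mul0r.
have ta : t a = 0 by rewrite /t !subrr !mul0r subr0 mul0r.
have sb : s b = 1 by rewrite /s -!expr2 divff.
have tb : t b = 0 by rewrite /t; ring.
have st x : s x + (1 - s x) = 1 by rewrite addrC subrK.
have conv (u v k : R) : 0 <= k <= 1 -> `|(1 - k) * u + k * v| <= (1 - k) * `|u| + k * `|v|.
  case/andP => k0 k1; apply: le_trans (ler_normD _ _) _.
  by rewrite !normrM (ger0_norm k0) ger0_norm // subr_ge0.
exists (fun x => `|t x| + `|s x| + `|1 - s x| - 1); split.
- move=> x; have := normr_ge0 (t x); have := ler_normD (s x) (1 - s x).
  by rewrite st normr1; lra.
- move=> x h.
  have h1 := ler_norm (s x); have h2 := ler_norm (1 - s x).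
  have h3 := ler_norm (- s x); have h4 := ler_norm (- (1 - s x)).
  have h5 := normr_ge0 (t x).
  rewrite normrN in h3; rewrite normrN in h4.
  have t0 : t x = 0 by apply/eqP; rewrite -normr_eq0; apply/eqP; lra.
  exists (s x); first by apply/andP; split; lra.
  move/eqP: t0; rewrite /t mulf_eq0 invr_eq0 (negbTE n0) orbF subr_eq0 => /eqP t0.
  apply/rowP => i; rewrite !mxE /s.
  have Hn : n = (b 0 0 - a 0 0) ^+ 2 + (b 0 1 - a 0 1) ^+ 2 by [].
  have i01 : i = 0 \/ i = 1.
    case: (unliftP 0 i) => [j|] ->; [right; rewrite [j]ord1; exact/val_inj|by left].
  set k := ((x 0 0 - a 0 0) * _ + _).
  have -> : (1 - k / n) * a 0 i + k / n * b 0 i = (a 0 i * n + k * (b 0 i - a 0 i)) / n.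
    by field.
  apply: (mulIf n0); rewrite mulfVK // /k Hn; case: i01 => ->.
    apply/eqP; rewrite -subr_eq0; apply/eqP.
    transitivity (((x 0 0 - a 0 0) * (b 0 1 - a 0 1)) * (b 0 1 - a 0 1)
      - ((x 0 1 - a 0 1) * (b 0 0 - a 0 0)) * (b 0 1 - a 0 1)); first by ring.
    by rewrite t0 subrr.
  apply/eqP; rewrite -subr_eq0; apply/eqP.
  transitivity (((x 0 1 - a 0 1) * (b 0 0 - a 0 0)) * (b 0 0 - a 0 0)
      - ((x 0 0 - a 0 0) * (b 0 1 - a 0 1)) * (b 0 0 - a 0 0)); first by ring.
  by rewrite t0 subrr.
- by rewrite sa sb ta tb !normr0 subr0 subrr normr1 normr0; split; ring.
- move=> x y k hk; rewrite sE tE.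
  have -> : 1 - ((1 - k) * s x + k * s y) = (1 - k) * (1 - s x) + k * (1 - s y) by ring.
  have := conv (t x) (t y) k hk; have := conv (s x) (s y) k hk.
  have := conv (1 - s x) (1 - s y) k hk.
  lra.
have cE : forall u v : R, continuous (fun k : R => (1 - k) * u + k * v).
  move=> u v k; apply: cvgD; apply: cvgM; try exact: cvg_cst; try exact: cvg_id.
  by apply: cvgB; [exact: cvg_cst|exact: cvg_id].
move=> x y k.
have -> : (fun k : R => `|t ((1 - k) *: x + k *: y)| + `|s ((1 - k) *: x + k *: y)|
    + `|1 - s ((1 - k) *: x + k *: y)| - 1) =
  (fun k : R => `|(1 - k) * t x + k * t y| + `|(1 - k) * s x + k * s y|
    + `|1 - ((1 - k) * s x + k * s y)| - 1).
  by apply/funext => j; rewrite sE tE.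
apply: cvgB; last exact: cvg_cst.
apply: cvgD; [apply: cvgD|]; apply: cvg_norm; try exact: cE.
by apply: cvgB; [exact: cvg_cst|exact: cE].
Qed.

(** By compactness [g] attains a positive minimum on each of the finitely many segments; half of it
    leaves room for the strict inequality. *)
Lemma gauge_gap (g : point -> R) (Z : seq (point * point)) :
  (forall x y : point, continuous (fun k : R => g ((1 - k) *: x + k *: y))) ->
  (forall s p, s \in Z -> seg s.1 s.2 p -> 0 < g p) ->
  exists2 eps, 0 < eps & forall s p, s \in Z -> seg s.1 s.2 p -> eps < g p.
Proof.
move=> gc; elim: Z => [|[x y] Z IH] gp; first by exists 1.
have [|eps eps0 epsP] := IH; first by move=> s p sZ; apply: gp; rewrite inE sZ orbT.
have [c cI cmin] := EVT_min ler01 (continuous_subspaceT (gc x y)).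
have g0 : 0 < g ((1 - c) *: x + c *: y).
  by apply: (gp (x, y)); [rewrite inE eqxx|exists c; rewrite ?itvP // cI].
exists (Num.min eps (g ((1 - c) *: x + c *: y) / 2)).
  by rewrite lt_min eps0 divr_gt0.
move=> s p; rewrite gt_min inE => /orP[/eqP-> /= [k kI ->]|sZ sp].
  by apply/orP; right; apply: lt_le_trans (cmin k _); rewrite ?in_itv //; lra.
by rewrite (epsP s).
Qed.

Definition segs_apart (x y x' y' : point) := forall p,
  seg x y p -> seg x' y' p ->
  [\/ (x, y) = (x', y'), (x, y) = (y', x')
    | p \in [:: x; y] /\ p \in [:: x'; y']].

(** Loops are allowed and mark points: by [segs_apart], a segment passing through [x] with [e x x]
    has [x] as an end. This keeps the vertices of a drawing out of the interiors of segments. *)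
Definition plane_graph (e : rel point) :=
  [/\ symmetric e,
      forall x y x' y', e x y -> e x' y' -> segs_apart x y x' y'
    & exists S : seq point, forall x y, e x y -> x \in S].

Lemma segs_apartC x y x' y' : segs_apart x y x' y' -> segs_apart x' y' x y.
Proof.
move=> D p h1 h2; case: (D p h2 h1) => [[-> ->]|[-> ->]|[]].
- exact: Or31.
- exact: Or32.
by move=> *; apply: Or33.
Qed.

Lemma mem_swap (p x y : point) : (p \in [:: x; y]) = (p \in [:: y; x]).
Proof. by rewrite !inE orbC. Qed.

Lemma segs_apart_swap x y x' y' : segs_apart x y x' y' -> segs_apart y x x' y'.
Proof.
move=> D p /seg_sym h1 h2; case: (D p h1 h2) => [[-> ->]|[-> ->]|[]].
- exact: Or32.
- exact: Or31.
by rewrite mem_swap => *; apply: Or33.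
Qed.

(** * Rerouting the segments at one end of [[a,b]] to the other end *)

Section Pull.
Variables (e : rel point) (a b : point).
Hypotheses (e_sym : symmetric e) (ab : a != b) (eab : e a b).
Hypothesis e_apart : forall x y x' y', e x y -> e x' y' -> segs_apart x y x' y'.
Variables (g : point -> R) (eps : R) (q : point -> point).
Hypotheses (ga : g a = 0) (gb : g b = 0) (g_convex : convex_along g).
Hypothesis eps0 : 0 < eps.
Hypothesis far_seg : forall x y p, e x y -> x != a -> x != b -> y != a -> y != b ->
  seg x y p -> eps < g p.
Hypothesis far_end : forall x y, e x y -> x != a -> x != b -> eps < g x.
Hypothesis q_seg : forall z, eps < g z -> seg a z (q z).
Hypothesis gq : forall z, eps < g z -> g (q z) = eps.

(* [q z] is the point where the spoke [a,z] leaves {g <= eps}. *)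
Definition spoke z := [&& e a z, z != a & z != b].

Lemma spoke_far z : spoke z -> eps < g z.
Proof. by case/and3P => ez za zb; apply: far_end za zb; rewrite e_sym; apply: ez. Qed.

Lemma inner_lt z p : spoke z -> seg b (q z) p -> p != q z -> g p < eps.
Proof.
move=> /spoke_far/gq gz [k /andP[k0 k1] ->] pq.
have kn1 : k < 1.
  rewrite lt_neqAle k1 andbT; apply: contra_neq pq => ->.
  by rewrite subrr scale0r scale1r add0r.
apply: le_lt_trans (g_convex _ _ _) _; first by rewrite k0.
by rewrite gb gz mulr0 add0r gtr_pMl.
Qed.

Lemma inner_le z p : spoke z -> seg b (q z) p -> g p <= eps.
Proof.
move=> sz h; have [->|pq] := eqVneq p (q z); first by rewrite gq ?spoke_far.
exact/ltW/(inner_lt sz).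
Qed.

(** The point [q z] lies strictly between [a] and [p] on the spoke. As [g a = 0], convexity would
    give [g (q z) < eps] if [g p] were at most [eps]. *)
Lemma outer_gt z p : spoke z -> seg (q z) z p -> p != q z -> eps < g p.
Proof.
move=> sz [k /andP[k0 k1] pE] pq; rewrite ltNge; apply/negP => gp.
have gz := spoke_far sz.
have [m /andP[m0 m1] qE] := q_seg gz.
have kn0 : 0 < k.
  rewrite lt_neqAle k0 andbT eq_sym; apply: contra_neq pq => k00.
  by rewrite pE k00 subr0 scale0r scale1r addr0.
have mn0 : 0 < m.
  rewrite lt_neqAle m0 andbT eq_sym; apply/eqP => m00.
  move: (gq gz); rewrite qE m00 subr0 scale0r scale1r addr0 ga => h.
  by move: eps0; rewrite -h ltxx.
have mn1 : m < 1.
  rewrite lt_neqAle m1 andbT; apply/eqP => m11.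
  move: (gz); rewrite -(gq gz) qE m11 subrr scale0r scale1r add0r.
  by rewrite ltxx.
have D0 : 0 < m + k * (1 - m) by nra.
(* The parameter of [q z] on the segment from [a] to [p], where [m] and [m + k * (1 - m)] are those
   of [q z] and [p] on [[a,z]]. *)
pose l := m / (m + k * (1 - m)).
have l0 : 0 <= l by rewrite divr_ge0 // ltW.
have l1 : l < 1 by rewrite ltr_pdivrMr //; nra.
have : g (q z) <= (1 - l) * g a + l * g p.
  apply: le_trans (g_convex _ _ _); last by rewrite l0 ltW.
  suff -> : q z = (1 - l) *: a + l *: p by [].
  rewrite pE qE; apply/rowP => i; rewrite !mxE /l.
  by field; rewrite gt_eqF.
rewrite gq // ga mulr0 add0r leNgt => /negP; apply.
by apply: le_lt_trans (ler_wpM2l l0 gp) _; rewrite gtr_pMl.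
Qed.

Lemma outer_ge z p : spoke z -> seg (q z) z p -> eps <= g p.
Proof.
move=> sz h; have [->|pq] := eqVneq p (q z); first by rewrite gq ?spoke_far.
exact/ltW/(outer_gt sz).
Qed.

Lemma outer_sub z p : spoke z -> seg (q z) z p -> seg a z p.
Proof.
move=> /spoke_far/q_seg [m /andP[m0 m1] ->] [k /andP[k0 k1] ->].
exists (m + k * (1 - m)); first by apply/andP; split; nra.
by apply/rowP => i; rewrite !mxE; ring.
Qed.

Lemma spokeP z : spoke z -> [/\ e a z, z != a & z != b].
Proof. by case/and3P. Qed.

Lemma q_inj z z' : spoke z -> spoke z' -> q z = q z' -> z = z'.
Proof.
move=> sz sz' E; have [ez za _] := spokeP sz; have [ez' za' _] := spokeP sz'.
have h := q_seg (spoke_far sz); have h' := q_seg (spoke_far sz').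
rewrite -E in h'.
case: (e_apart ez ez' h h') => [[]|[]|[+ _]] //.
  by move=> _ Eza; rewrite Eza eqxx in za.
rewrite !inE => /orP[]/eqP Eq.
  by move: (gq (spoke_far sz)); rewrite Eq ga => h0; move: eps0; rewrite -h0 ltxx.
by move: (spoke_far sz); rewrite -{1}(gq (spoke_far sz)) Eq ltxx.
Qed.

(** Old corners have gauge 0, when they are [a] or [b], or gauge above [eps]; the new ones have
    gauge exactly [eps]. *)
Lemma q_fresh z x y : spoke z -> e x y -> q z != x.
Proof.
move=> sz exy; apply/eqP => E; have := gq (spoke_far sz); rewrite E => h.
have [xa|xa] := eqVneq x a; first by move: eps0; rewrite -h xa ga ltxx.
have [xb|xb] := eqVneq x b; first by move: eps0; rewrite -h xb gb ltxx.
by have := far_end exy xa xb; rewrite h ltxx.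
Qed.

Lemma apart_old_outer x y z : e x y -> x != a -> y != a -> spoke z ->
  segs_apart x y (q z) z.
Proof.
move=> exy xa ya sz p h1 h2; have [ez za zb] := spokeP sz.
have h3 := outer_sub sz h2.
case: (e_apart exy ez h1 h3) => [[E _]|[_ E]|[h4]].
- by rewrite E eqxx in xa.
- by rewrite E eqxx in ya.
rewrite !inE => /orP[]/eqP Ep.
  by move: h4; rewrite Ep !inE ![a == _]eq_sym (negbTE xa) (negbTE ya).
by apply: Or33; split; [rewrite -mem_seq2|rewrite Ep eqxx orbT].
Qed.

(** An old segment missing [b] stays outside the neighbourhood. If one ending at [b] met the inner
    piece elsewhere, both would lie on one ray from [b]: either [q z] would be a forbidden meeting
    point of two old segments, or the other end of the old segment would fall into the
    neighbourhood. *)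
Lemma apart_old_inner x y z : e x y -> x != a -> y != a -> spoke z ->
  segs_apart x y b (q z).
Proof.
wlog xb : x y / x = b \/ (x != b /\ y != b).
  move=> W exy xa ya sz; have [xb|xb] := eqVneq x b; first by apply: W; auto.
  have [yb|yb] := eqVneq y b; last by apply: W; auto.
  by apply/segs_apart_swap/W => //; [left|rewrite e_sym].
move=> exy xa ya sz p h1 h2.
case: xb => [xb|[xb yb]]; last first.
  by have := far_seg exy xa xb ya yb h1; rewrite ltNge (inner_le sz h2).
subst x; have [pb|pb] := eqVneq p b.
  by apply: Or33; rewrite pb !inE !eqxx.
have yb : y != b.
  apply: contra_neq pb => yb; case: h1 => k _ ->.
  by rewrite yb -scalerDl subrK scale1r.
have [ez za zb] := spokeP sz.
have gy : eps < g y by apply: (@far_end y b); rewrite 1?e_sym.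
exfalso; case: (seg_collinear h1 h2 pb) => h3.
  case: (e_apart exy ez h3 (q_seg (spoke_far sz))) => [[E _]|[E _]|[_]].
  - by move: ab; rewrite E eqxx.
  - by rewrite E eqxx in zb.
  rewrite !inE => /orP[]/eqP Eq.
    by move: (q_fresh sz eab); rewrite Eq eqxx.
  by move: (@q_fresh z z a sz); rewrite Eq e_sym eqxx => /(_ ez).
by have := inner_le sz h3; rewrite leNgt gy.
Qed.

Lemma apart_inner z z' : spoke z -> spoke z' -> segs_apart b (q z) b (q z').
Proof.
move=> sz sz' p h1 h2.
have [pb|pb] := eqVneq p b; first by apply: Or33; rewrite pb !inE !eqxx.
apply: Or31; congr (_, _).
wlog h : z z' sz sz' h1 h2 / seg b (q z) (q z').
  move=> W; case: (seg_collinear h1 h2 pb) => h; first exact: W h.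
  by symmetry; apply: W h.
apply/eqP; rewrite eq_sym; apply/negPn/negP => n.
by have := inner_lt sz h n; rewrite gq ?spoke_far // ltxx.
Qed.

(** The inner piece lies in [{g <= eps}] and the outer one in [{g >= eps}]; each reaches the common
    boundary only at its point [q z] or [q z']. *)
Lemma apart_inner_outer z z' : spoke z -> spoke z' -> segs_apart b (q z) (q z') z'.
Proof.
move=> sz sz' p h1 h2.
have E : p = q z.
  apply/eqP/negPn/negP => n; have := inner_lt sz h1 n.
  by rewrite ltNge (outer_ge sz' h2).
have E' : p = q z'.
  apply/eqP/negPn/negP => n; have := outer_gt sz' h2 n.
  by rewrite ltNge (inner_le sz h1).
by apply: Or33; rewrite {1}E E' !inE !eqxx orbT.
Qed.

Lemma apart_outer z z' : spoke z -> spoke z' -> segs_apart (q z) z (q z') z'.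
Proof.
move=> sz sz' p h1 h2.
have [ez za zb] := spokeP sz; have [ez' za' zb'] := spokeP sz'.
case: (e_apart ez ez' (outer_sub sz h1) (outer_sub sz' h2)) => [[->]|[_ E]|[]].
- exact: Or31.
- by rewrite E eqxx in za.
have pa : p != a.
  apply/eqP => E; have := outer_ge sz h1; rewrite E ga leNgt eps0 //.
rewrite !inE (negbTE pa) /= => /eqP E /eqP E'.
by apply: Or33; rewrite -E -E' eqxx !orbT.
Qed.

(** Each spoke [[a,z]] is rerouted through [q z], and [a] is dropped. The finite list [S] makes the
    quantification over spokes boolean; the loop at [b] lets [b] carry the moved vertex. *)
Definition pulled (S : seq point) : rel point := fun x y =>
  [|| [&& e x y, x != a & y != a], (x == b) && (y == b) |
    has (fun z => spoke z && [|| (x == b) && (y == q z), (x == q z) && (y == b),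
      (x == q z) && (y == z) | (x == z) && (y == q z)]) S].

Inductive pulled_spec : point -> point -> Prop :=
  | PulledOld x y of e x y & x != a & y != a : pulled_spec x y
  | PulledLoop : pulled_spec b b
  | PulledInner z of spoke z : pulled_spec b (q z)
  | PulledOuter z of spoke z : pulled_spec (q z) z.

Lemma pulledP S x y : pulled S x y -> pulled_spec x y \/ pulled_spec y x.
Proof.
case/or3P => [/and3P[]|/andP[/eqP-> /eqP->]|/hasP[z _ /andP[sz]]].
- by left; apply: PulledOld.
- by left; apply: PulledLoop.
case/or4P => /andP[/eqP-> /eqP->].
- by left; apply: PulledInner.
- by right; apply: PulledInner.
- by left; apply: PulledOuter.
- by right; apply: PulledOuter.
Qed.

Lemma apart_loop x x' y' : x \in [:: x'; y'] -> segs_apart x x x' y'.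
Proof.
move=> xi p [k _ ->] _; rewrite -scalerDl subrK scale1r.
by apply: Or33; split=> //; rewrite inE eqxx.
Qed.

Lemma pulled_apart S x y x' y' : pulled S x y -> pulled S x' y' ->
  segs_apart x y x' y'.
Proof.
have loop x0 y0 : pulled_spec x0 y0 -> segs_apart b b x0 y0.
  case=> {x0 y0} [x0 y0 exy xa ya||z sz|z sz].
  - have [bi|bn] := boolP (b \in [:: x0; y0]); first exact: apart_loop.
    move=> p [k _ ->]; rewrite -scalerDl subrK scale1r => h.
    have hb : seg a b b by apply: seg_end; rewrite !inE eqxx orbT.
    case: (e_apart exy eab h hb) => [[E _]|[_ E]|[h4 _]].
    + by rewrite E eqxx in xa.
    + by rewrite E eqxx in ya.
    + by rewrite h4 in bn.
  - by apply: apart_loop; rewrite inE eqxx.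
  - by apply: apart_loop; rewrite inE eqxx.
  move=> p [k _ ->]; rewrite -scalerDl subrK scale1r => h.
  by have := outer_ge sz h; rewrite gb leNgt eps0.
have H x0 y0 x1 y1 : pulled_spec x0 y0 -> pulled_spec x1 y1 -> segs_apart x0 y0 x1 y1.
  case=> {x0 y0} [x0 y0 exy xa ya||z sz|z sz]; last 2 first.
  - case=> {x1 y1} [x1 y1 exy1 xa1 ya1||z1 sz1|z1 sz1].
    + exact/segs_apartC/apart_old_inner.
    + exact/segs_apartC/loop/PulledInner.
    + exact: apart_inner.
    + exact: apart_inner_outer.
  - case=> {x1 y1} [x1 y1 exy1 xa1 ya1||z1 sz1|z1 sz1].
    + exact/segs_apartC/apart_old_outer.
    + exact/segs_apartC/loop/PulledOuter.
    + exact/segs_apartC/apart_inner_outer.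
    + exact: apart_outer.
  - case=> {x1 y1} [x1 y1 exy1 xa1 ya1||z1 sz1|z1 sz1].
    + exact: e_apart.
    + exact/segs_apartC/loop/PulledOld.
    + exact: apart_old_inner.
    + exact: apart_old_outer.
  exact: loop.
case/pulledP => h; case/pulledP => h'.
- exact: H.
- exact/segs_apartC/segs_apart_swap/segs_apartC/H.
- exact/segs_apart_swap/H.
- exact/segs_apart_swap/segs_apartC/segs_apart_swap/segs_apartC/H.
Qed.

End Pull.

Lemma plane_graph_pull (e : rel point) (a b : point) :
  plane_graph e -> e a b -> a != b ->
  exists (e' : rel point) (q : point -> point),
  [/\ plane_graph e', e' b b,
      forall x y, e x y -> x != a -> y != a -> e' x y,
      forall z, e a z -> z != a -> z != b -> e' b (q z) /\ e' (q z) z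
    & (forall z x y, e a z -> z != a -> z != b -> e x y -> q z != x) /\
      (forall z z', e a z -> z != a -> z != b ->
         e a z' -> z' != a -> z' != b -> q z = q z' -> z = z')].
Proof.
case=> e_sym e_apart [S eS] eab ab.
have [g [g_ge0 g0 [ga gb] g_convex g_cont]] := exists_gauge ab.
(* Pairs [(x, x)] are included and stand for single points, so one [eps] serves both [far_seg] and
   [far_end]. *)
pose Z := [seq s <- [seq (x, y) | x <- S, y <- S] |
  `[< forall p, seg s.1 s.2 p -> 0 < g p >]].
have [s p|eps eps0 epsP] := @gauge_gap g Z g_cont.
  by rewrite mem_filter => /andP[/asboolP + _]; apply.
have pos x y p : e x y -> x != a -> x != b -> y != a -> y != b ->
    seg x y p -> 0 < g p.
  move=> exy xa xb ya yb h; rewrite ltNge; apply/negP => /g0 h'.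
  case: (e_apart _ _ _ _ exy eab p h h') => [[E _]|[E _]|[]].
  - by rewrite E eqxx in xa.
  - by rewrite E eqxx in xb.
  by rewrite !inE => /orP[] /eqP->; rewrite ?(negbTE xa) ?(negbTE xb) ?(negbTE ya) ?(negbTE yb).
have pos' x y : e x y -> x != a -> x != b -> 0 < g x.
  move=> exy xa xb; rewrite ltNge; apply/negP => /g0 h'.
  have h : seg x y x by apply: seg_end; rewrite inE eqxx.
  case: (e_apart _ _ _ _ exy eab x h h') => [[E _]|[E _]|[_]].
  - by rewrite E eqxx in xa.
  - by rewrite E eqxx in xb.
  by rewrite !inE (negbTE xa) (negbTE xb).
have far_seg x y p : e x y -> x != a -> x != b -> y != a -> y != b ->
    seg x y p -> eps < g p.
  move=> exy xa xb ya yb; apply: (epsP (x, y)); rewrite mem_filter; apply/andP; split.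
    by apply/asboolP => p'; apply: pos.
  by apply: allpairs_f; [apply: eS exy|apply: (eS y x); rewrite e_sym].
have far_end x y : e x y -> x != a -> x != b -> eps < g x.
  move=> exy xa xb; apply: (epsP (x, x)); last by apply: seg_end; rewrite inE eqxx.
  rewrite mem_filter; apply/andP; split.
    apply/asboolP => p' [k _ ->]; rewrite -scalerDl subrK scale1r.
    exact: (pos' x y).
  by apply: allpairs_f; apply: eS exy.
(* Along [[a,z]] the gauge runs from 0 to a value above [eps], so the intermediate value theorem
   yields [q z]. Where [g z] does not exceed [eps], the choice [z] is a dummy. *)
have [q qP] : {q : point -> point & forall z, eps < g z -> seg a z (q z) /\ g (q z) = eps}.
  apply: (@boolp.choice _ _ (fun z w => eps < g z -> seg a z w /\ g w = eps)) => z.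
  have [gz|] := ltP eps (g z); last by exists z.
  have [|k kI kE] := @IVT R _ 0 1 eps ler01 (continuous_subspaceT (g_cont a z)).
    rewrite subr0 subrr !scale1r !scale0r addr0 add0r ga.
    by rewrite min_l ?max_r ?(ltW gz) ?(ltW eps0) // ltW // (lt_trans eps0).
  exists ((1 - k) *: a + k *: z) => _; split=> //.
  by exists k => //; move: kI; rewrite in_itv.
exists (pulled e a b q S), q.
have q_seg z gz := (qP z gz).1; have gq z gz := (qP z gz).2.
have spk z : e a z -> z != a -> z != b -> spoke e a b z by rewrite /spoke => -> -> ->.
have zS z : e a z -> z \in S by rewrite e_sym; apply: eS.
split.
- split.
  + move=> x y; rewrite /pulled e_sym; congr [|| _, _ | _].
    * by rewrite [(x != a) && _]andbC.
    * by rewrite andbC.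
    apply: eq_has => z; congr (_ && _).
    rewrite [(x == b) && _]andbC [(x == q z) && (y == b)]andbC.
    rewrite [(x == q z) && (y == z)]andbC [(x == z) && _]andbC.
    by do 4!case: (_ && _).
  + exact: (@pulled_apart e a b e_sym ab eab e_apart g eps q ga gb g_convex eps0 far_seg far_end
        q_seg gq S).
  exists (b :: S ++ map q S) => x y h.
  have mq z : spoke e a b z -> q z \in map q S.
    by case/spokeP => ez _ _; apply/map_f/zS.
  case/pulledP: h; case=> {x y} [x y exy _ _||z sz|z sz]; rewrite ?mem_head //=;
    rewrite in_cons mem_cat ?mq ?orbT //.
  - by rewrite (eS _ _ exy) orbT.
  - by rewrite (eS y x) ?orbT // e_sym.
  - by case/spokeP: sz => ez _ _; rewrite zS ?orbT.
- by rewrite /pulled !eqxx orbT.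
- by move=> x y exy xa ya; rewrite /pulled exy xa ya.
- move=> z ez za zb; rewrite /pulled.
  split; apply/or3P/Or33/hasP; exists z; rewrite ?zS //= spk ?eqxx ?orbT //.
split.
- by move=> z x y ez za zb; apply: (@q_fresh e a b e_sym g eps q ga gb eps0 far_end gq); exact: spk.
- move=> z z' ez za zb ez' za' zb'.
  apply: (@q_inj e a b e_sym e_apart g eps q ga eps0 far_end q_seg gq); exact: spk.
Qed.
End Gauge.

(** * Contraction of an edge of a planar graph *)

Section Drawing.
Local Open Scope ring_scope.
Variable R : realType.
Local Notation point := 'rV[R]_2.
Local Notation seg := (@on_segment R).

Definition graph_path (e : rel point) (x y : point) (s : seq point) : Prop :=
  exists p, [/\ s = x :: p, path e x p, uniq (x :: p) & last x p = y].

Lemma graph_path_rev (e : rel point) x y s : symmetric e ->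
  graph_path e x y s -> graph_path e y x (rev s).
Proof.
move=> es [p [-> pp pu <-]]; exists (rev (belast x p)); split.
- by rewrite lastI rev_rcons.
- by rewrite rev_path (eq_path (_ : _ =2 e)) // => a b; rewrite es.
- by rewrite -rev_rcons -lastI rev_uniq.
by case: p {pp pu} => //= a p; rewrite rev_cons last_rcons.
Qed.

(* [pos] need not be injective: once [u] has been pulled onto [v] both sit at the
   same point and the arc of [uv] is a single point. *)
Record weak_drawing (G : sgraph) (e : rel point) (pos : G -> point)
    (arc : G -> G -> seq point) : Prop := WeakDrawing {
  wd_plane : plane_graph e;
  wd_pos : forall w, e (pos w) (pos w);
  wd_path : forall x y, adj x y -> graph_path e (pos x) (pos y) (arc x y);
  wd_rev : forall x y, adj x y -> arc y x = rev (arc x y);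
  wd_vertex : forall x y w, adj x y -> pos w \in arc x y ->
    pos w \in [:: pos x; pos y];
  wd_disjoint : forall x y x' y' c, adj x y -> adj x' y' ->
    c \in arc x y -> c \in arc x' y' ->
    [set x; y] = [set x'; y'] \/ c \in [:: pos x; pos y]
}.

Lemma wd_corner G e pos arc x y c : @weak_drawing G e pos arc -> adj x y ->
  c \in arc x y -> exists d, e c d.
Proof.
move=> D xy; have [p [-> pp _ _]] := wd_path D xy.
have [es _ _] := wd_plane D.
rewrite inE => /orP[/eqP->|]; first by exists (pos x); apply: (wd_pos D).
elim: p (pos x) pp => //= z p IH x0 /andP[xz pz]; rewrite inE.
by case/orP => [/eqP->|]; [exists x0; rewrite es|apply: IH pz].
Qed.

(** * Moving a vertex along the first segment of an arc *)

Section PullDrawing.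
Variables (G : sgraph) (e : rel point) (pos : G -> point) (arc : G -> G -> seq point).
Hypotheses (D : weak_drawing e pos arc) (pos_inj : injective pos).
Variables (u v : G) (b : point) (r : seq point).
Hypotheses (uv : adj u v) (arc_uv : arc u v = pos u :: b :: r).
Local Notation a := (pos u).
Variables (e' : rel point) (q : point -> point).
Hypotheses (e'_plane : plane_graph e') (e'b : e' b b).
Hypothesis e'_old : forall x y, e x y -> x != a -> y != a -> e' x y.
Hypothesis e'_spoke : forall z, e a z -> z != a -> z != b -> e' b (q z) /\ e' (q z) z.
Hypothesis q_fresh : forall z x y, e a z -> z != a -> z != b -> e x y -> q z != x.
Hypothesis q_inj : forall z z', e a z -> z != a -> z != b ->
         e a z' -> z' != a -> z' != b -> q z = q z' -> z = z'.

Definition pull_pos w := if w == u then b else pos w.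

(** An arc leaving [u] along the spoke [[a,z]] now starts at [b] and passes through [q z]. Lists
    with fewer than two points are a default case. *)
Definition bend s := if s is _ :: (z :: _) as s' then b :: q z :: s' else s.

Definition pull_arc x y : seq point :=
  if (x == u) && (y == v) then b :: r
  else if (x == v) && (y == u) then rev (b :: r)
  else if x == u then bend (arc u y)
  else if y == u then rev (bend (arc u x))
  else arc x y.

Lemma pull_posT w : w != u -> pull_pos w = pos w.
Proof. by rewrite /pull_pos => /negbTE->. Qed.

Lemma pull_pos_u : pull_pos u = b.
Proof. by rewrite /pull_pos eqxx. Qed.

Lemma b_neq_a : b != a.
Proof.
have [p [E _ pu _]] := wd_path D uv.
by move: pu; rewrite -E arc_uv /= !inE negb_or eq_sym => /andP[/andP[]].
Qed.

Lemma e_ab : e a b.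
Proof.
have [p [E pp _ _]] := wd_path D uv.
by move: E pp; rewrite arc_uv => -[<-] /= /andP[].
Qed.

Lemma e_sym : symmetric e. Proof. by case: (wd_plane D). Qed.

Lemma e'_sym : symmetric e'. Proof. by case: e'_plane. Qed.

Lemma set2_eq (x y z : G) : [set x; y] = [set x; z] -> y = z.
Proof.
move=> /setP E; have := E y; have := E z; rewrite !inE !eqxx !orbT.
by case/orP => /eqP-> //; rewrite orbb => /esym/eqP.
Qed.

(** The point [b] is on the arc of [uv], and different arcs share only points that are ends of both.
    Were [b] also on the arc of [uw], it would be the position of both [v] and [w]. *)
Lemma spoke_arc w : adj u w -> w != v -> exists z tl,
  [/\ arc u w = a :: z :: tl, e a z, z != a & z != b] /\
  [/\ path e z tl, uniq (z :: tl), a \notin z :: tl, b \notin z :: tl & last z tl = pos w].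
Proof.
move=> uw wv; have [p [E pp pu lp]] := wd_path D uw.
case: p E pp pu lp => [|z tl] E /=.
  by move=> _ _ /pos_inj uw'; rewrite uw' adj_irr in uw.
case/andP => az pz /and3P[an zn tu] lp.
have bn : b \notin z :: tl.
  apply/negP => bi.
  have b1 : b \in arc u v by rewrite arc_uv !inE eqxx orbT.
  have b2 : b \in arc u w by rewrite E inE bi orbT.
  case: (wd_disjoint D uv uw b1 b2) => [/set2_eq vw|]; first by rewrite vw eqxx in wv.
  rewrite !inE (negbTE b_neq_a) /= => /eqP bv.
  case: (wd_disjoint D uw uv b2 b1) => [/set2_eq vw|]; first by rewrite vw eqxx in wv.
  rewrite !inE (negbTE b_neq_a) /= bv => /eqP/pos_inj vw.
  by rewrite vw eqxx in wv.
exists z, tl; split; split => //=.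
- by apply: contraNneq an => <-; rewrite mem_head.
- by apply: contraNneq bn => <-; rewrite mem_head.
by rewrite zn tu.
Qed.

Lemma path_avoid x p : path e x p -> a \notin x :: p -> path e' x p.
Proof.
elim: p x => //= y p IH x /andP[xy yp]; rewrite in_cons negb_or => /andP[ax ay].
rewrite e'_old ?IH // 1?eq_sym //.
by apply: contraNneq ay => ->; rewrite mem_head.
Qed.

Lemma bend_path w : adj u w -> w != v -> graph_path e' b (pos w) (bend (arc u w)).
Proof.
move=> uw wv; have [z [tl [[E az za zb] [pz zu an bn lz]]]] := spoke_arc uw wv.
rewrite E; have [e1 e2] := e'_spoke az za zb.
exists (q z :: z :: tl); split=> //=.
  by rewrite e1 e2 path_avoid.
have fresh x : x \in z :: tl -> q z != x.
  move=> xi; have [|d] := @wd_corner G e pos arc u w x D uw; last exact: q_fresh.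
  by rewrite E in_cons xi orbT.
have qb : q z != b by apply: (@q_fresh z b a) => //; rewrite e_sym e_ab.
have zn : q z \notin z :: tl by apply/negP => /fresh; rewrite eqxx.
by rewrite -/(uniq (z :: tl)) zu -/(q z \in z :: tl) zn in_cons negb_or eq_sym qb bn.
Qed.

(** Sorts the corners of a new arc by origin: old corner, [b], or new corner [q z]. The vertex and
    disjointness conditions of [pull_drawing] are case analyses over it. *)
Lemma mem_pull_arc x y c : adj x y -> c \in pull_arc x y ->
  [\/ c \in arc x y /\ c != a, c = b /\ (x = u \/ y = u)
    | exists w z tl, [/\ [set x; y] = [set u; w], adj u w, w != v,
        arc u w = a :: z :: tl & c = q z]].
Proof.
have H w : adj u w -> w != v -> c \in bend (arc u w) ->
  [\/ c \in arc u w /\ c != a, c = b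
    | exists z tl, arc u w = a :: z :: tl /\ c = q z].
  move=> uw wv; have [z [tl [[-> az za zb] [pz zu an bn lz]]]] := spoke_arc uw wv.
  rewrite /= in_cons => /orP[/eqP->|]; first exact: Or32.
  rewrite in_cons => /orP[/eqP->|ci]; first by apply: Or33; exists z, tl.
  by apply: Or31; rewrite in_cons ci orbT; split=> //; apply: contraNneq an => <-.
have Huv : c \in b :: r -> c \in arc u v /\ c != a.
  move=> ci; rewrite arc_uv inE ci orbT; split=> //.
  have [p [E _ pu _]] := wd_path D uv.
  by move: pu; rewrite -E arc_uv /= => /andP[an _]; apply: contraNneq an => <-.
move=> xy; rewrite /pull_arc.
case: ifP => [/andP[/eqP-> /eqP->]|n1]; first by move/Huv; apply: Or31.
case: ifP => [/andP[/eqP-> /eqP->]|n2].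
  by rewrite mem_rev => /Huv; rewrite (wd_rev D uv) mem_rev; apply: Or31.
case: ifP => [/eqP xu|xu].
  subst x; rewrite eqxx /= in n1; move/(H y xy (negbT n1)) => [h|h|[z [tl [h1 h2]]]].
  - exact: Or31.
  - by apply: Or32; auto.
  by apply: Or33; exists y, z, tl; split=> //; apply: negbT.
case: ifP => [/eqP yu|yu].
  subst y; rewrite eqxx andbT in n2; have ux : adj u x by rewrite adj_sym.
  rewrite mem_rev; move/(H x ux (negbT n2)) => [h|h|[z [tl [h1 h2]]]].
  - by apply: Or31; rewrite (wd_rev D ux) mem_rev.
  - by apply: Or32; auto.
  by apply: Or33; exists x, z, tl; split=> //; [rewrite setUC|apply: negbT].
move=> ci; apply: Or31; split=> //; apply/eqP => ca.
have := @wd_vertex _ _ _ _ D x y u xy; rewrite -ca => /(_ ci).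
by rewrite ca !inE => /orP[]/eqP/pos_inj E; [move: xu|move: yu]; rewrite E eqxx.
Qed.

Lemma pull_vertex_end x y c : c != a -> c \in [:: pos x; pos y] ->
  c \in [:: pull_pos x; pull_pos y].
Proof.
move=> ca; have H z : c = pos z -> c = pull_pos z.
  by move=> E; rewrite pull_posT //; apply: contra_neq ca => <-.
by rewrite !inE => /orP[]/eqP/H->; rewrite eqxx ?orbT.
Qed.

Lemma pull_b_end x y : x = u \/ y = u -> b \in [:: pull_pos x; pull_pos y].
Proof. by case=> ->; rewrite !inE /pull_pos !eqxx ?orbT. Qed.

Lemma pull_b_arc x y : adj x y -> b \in arc x y -> b \in [:: pull_pos x; pull_pos y].
Proof.
move=> xy bi; have bu : b \in arc u v by rewrite arc_uv !inE eqxx orbT.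
case: (wd_disjoint D xy uv bi bu) => [/setP /(_ u)|]; last exact/pull_vertex_end/b_neq_a.
by rewrite !in_set2 eqxx => /orP[]/eqP E; apply: pull_b_end; rewrite E; auto.
Qed.

Lemma pull_fresh w z tl c d : adj u w -> w != v -> arc u w = a :: z :: tl ->
  e c d -> q z != c.
Proof.
move=> uw wv E; have [z' [tl' [[E' az za zb] _]]] := spoke_arc uw wv.
by move: E'; rewrite E => -[? _]; subst z'; apply: q_fresh.
Qed.

Lemma pull_drawing : weak_drawing e' pull_pos pull_arc.
Proof.
split=> //.
- move=> w; rewrite /pull_pos; case: eqP => // /eqP wu; apply: e'_old; first exact: (wd_pos D).
    by apply: contra_neq wu => /pos_inj.
  by apply: contra_neq wu => /pos_inj.
- move=> x y xy; rewrite /pull_arc.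
  have Hb w : adj u w -> w != v -> graph_path e' (pull_pos u) (pull_pos w) (bend (arc u w)).
    move=> uw wv; rewrite pull_pos_u pull_posT; first exact: bend_path.
    by apply: contraTneq uw => ->; rewrite adj_irr.
  have Huv : graph_path e' (pull_pos u) (pull_pos v) (b :: r).
    rewrite pull_pos_u pull_posT 1?eq_sym ?(adj_neq uv) //.
    have [p [E pp pu lp]] := wd_path D uv.
    move: E pp pu lp; rewrite arc_uv => -[<-] /= /andP[_ pr] /andP[an ru] lr.
    by exists r; split=> //; apply: path_avoid.
  case: ifP => [/andP[/eqP-> /eqP->]|n1] //.
  case: ifP => [/andP[/eqP-> /eqP->]|n2]; first exact/(graph_path_rev e'_sym).
  case: ifP => [/eqP xu|xu].
    by subst x; apply: Hb => //; rewrite eqxx /= in n1; apply: negbT.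
  case: ifP => [/eqP yu|yu].
    subst y; apply/(graph_path_rev e'_sym)/Hb; first by rewrite adj_sym.
    by rewrite eqxx andbT in n2; apply: negbT.
  rewrite !pull_posT ?xu ?yu //.
  have [p [E pp pu lp]] := wd_path D xy; exists p; split=> //.
  apply: path_avoid => //; rewrite -E; apply/negP => ai.
  have := wd_vertex D xy ai; rewrite !inE => /orP[]/eqP/pos_inj E';
    [move: xu|move: yu]; by rewrite E' eqxx.
- move=> x y xy; rewrite /pull_arc.
  have [xu|xu] := eqVneq x u.
    subst x; have [yu|yu] := eqVneq y u; first by rewrite yu adj_irr in xy.
    have [yv|yv] := eqVneq y v; first by [].
    by rewrite (negbTE (adj_neq uv)).
  have [yu|yu] := eqVneq y u; last by rewrite /= !andbF (wd_rev D xy).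
  by rewrite andbF /= andbT; case: (x == v); rewrite revK.
- move=> x y w xy.
  case/(mem_pull_arc xy) => [[]||].
  + have [->|wu] := eqVneq w u; first by rewrite pull_pos_u => h _; apply: pull_b_arc.
    rewrite {1 2}/pull_pos (negbTE wu) => h1 h2; rewrite (pull_posT wu).
    by apply: pull_vertex_end h2 _; apply: (wd_vertex D).
  + by case=> -> ; apply: pull_b_end.
  case=> w' [z [tl [Exy uw wv Ew Eq]]].
  have := @pull_fresh w' z tl (pull_pos w) _ uw wv Ew; rewrite -Eq eqxx.
  have [->|wu] := eqVneq w u.
    by rewrite pull_pos_u => /(_ a); rewrite e_sym => /(_ e_ab).
  by rewrite (pull_posT wu) => /(_ _ (wd_pos D w)).
move=> x y x' y' c xy xy'.
case/(mem_pull_arc xy) => [[c1 ca]|[cb xu]|[w [z [tl [Exy uw wv Ew Eq]]]]].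
- case/(mem_pull_arc xy') => [[c1' ca']|[cb' xu']|[w' [z' [tl' [Exy' uw' wv' Ew' Eq']]]]].
  + by case: (wd_disjoint D xy xy' c1 c1') => h; [left|right; apply: pull_vertex_end].
  + by right; rewrite cb' in c1 *; apply: pull_b_arc.
  + have [d cd] := wd_corner D xy c1.
    by have := pull_fresh uw' wv' Ew' cd; rewrite Eq' eqxx.
- by move=> _; right; rewrite cb; apply: pull_b_end.
case/(mem_pull_arc xy') => [[c1' ca']|[cb' xu']|[w' [z' [tl' [Exy' uw' wv' Ew' Eq']]]]].
- have [d cd] := wd_corner D xy' c1'.
  by have := pull_fresh uw wv Ew cd; rewrite Eq eqxx.
- have := @pull_fresh w z tl b a uw wv Ew; rewrite e_sym e_ab -cb' Eq eqxx.
  by move/(_ isT).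
left; rewrite Exy Exy'.
have [z1 [tl1 [[E1 az za zb] _]]] := spoke_arc uw wv.
have [z2 [tl2 [[E2 az' za' zb'] _]]] := spoke_arc uw' wv'.
move: E1 E2; rewrite Ew Ew' => -[? _] [? _]; subst z1 z2.
(* A shared new corner means a shared spoke, hence a common corner [z] of the two old arcs. Unless
   the edges agree, [z] is an end of both arcs other than [a], so [w] and [w'] have the same
   position. *)
have Ez : z = z' by apply: q_inj => //; rewrite -Eq -Eq'.
subst z'.
have zw : z \in arc u w by rewrite Ew !inE eqxx orbT.
have zw' : z \in arc u w' by rewrite Ew' !inE eqxx orbT.
case: (wd_disjoint D uw uw' zw zw') => //; rewrite !inE (negbTE za) /= => /eqP h1.
case: (wd_disjoint D uw' uw zw' zw) => //; rewrite !inE (negbTE za) /= => /eqP h2.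
by rewrite (pos_inj (etrans (esym h1) h2)).
Qed.
End PullDrawing.

End Drawing.

Section PlanarContract.
Local Open Scope ring_scope.
Variable R : realType.
Local Notation point := 'rV[R]_2.
Local Notation seg := (@on_segment R).

(** Each pull removes the first corner of the arc of [uv]. While corners remain after [b], the point
    [b] is no vertex, so positions stay injective and the induction continues; the last pull puts
    [u] on [v]. *)
Lemma pull_edge (G : sgraph) e pos arc (u v : G) :
  @weak_drawing R G e pos arc -> injective pos -> adj u v ->
  exists e' pos' arc', [/\ @weak_drawing R G e' pos' arc', pos' u = pos' v
    & {in predC1 u &, injective pos'}].
Proof.
move=> D pos_inj uv; have [p [E _ _ _]] := wd_path D uv.
have [n] := ubnP (size p); elim: n p e pos arc D pos_inj E => // n IH p e pos arc D pos_inj E.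
have nuv : u != v := adj_neq uv.
have [p' [E' pp pu lp]] := wd_path D uv; move: E'; rewrite E => -[?]; subst p'.
case: p E pp pu lp => [|b r] E /=; first by move=> _ _ /pos_inj uv'; rewrite uv' eqxx in nuv.
case/andP=> eab pr /andP[an ru] lr sn.
have ab : pos u != b by apply: contraNneq an => ->; rewrite mem_head.
have [e' [q [e'p e'b e'old e'spoke [qf qi]]]] := plane_graph_pull (wd_plane D) eab ab.
have D' := pull_drawing D pos_inj uv E e'p e'b e'old e'spoke qf qi.
case: r => [|c r] in E pr an ru lr sn D' *.
  exists e', (pull_pos pos u b), (pull_arc arc u v b [::] q); split=> //.
    by rewrite /pull_pos eqxx eq_sym (negbTE nuv).
  by move=> x y; rewrite !inE /pull_pos => /negbTE-> /negbTE->; apply: pos_inj.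
apply: (IH (c :: r) _ _ _ D') => //.
- have bn w : w != u -> b <> pos w.
    move=> wu Eb; have bi : pos w \in arc u v by rewrite -Eb E !inE eqxx orbT.
    have := wd_vertex D uv bi; rewrite -Eb !inE eq_sym (negbTE ab) /= => /eqP bv.
    by move: ru; rewrite /= bv -lr /= mem_last.
  move=> x y; rewrite /pull_pos.
  have [->|xu] := eqVneq x u; have [->|yu] := eqVneq y u => //.
  + by move/bn => /(_ yu).
  + by move/esym/bn => /(_ xu).
  exact: pos_inj.
by rewrite /pull_pos /pull_arc !eqxx.
Qed.

Lemma polyline_path (e : rel point) p x i : path e x p -> (i < size p)%N ->
  e (x :: p)`_i (x :: p)`_i.+1.
Proof. by move=> /(pathP 0) h /h. Qed.

(* [rp x y] is the vertex of [G] from which the arc of [xy] starts when [K] arises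
   from [G] by identifying vertices at the same point. *)
Lemma weak_drawing_planar (G K : sgraph) e pos arc (pos' : K -> point) (rp : K -> K -> G) :
  @weak_drawing R G e pos arc -> injective pos' ->
  (forall x y, adj x y -> adj (rp x y) (rp y x)) ->
  (forall x y, pos (rp x y) = pos' x) ->
  planar R K.
Proof.
move=> D pos_inj rp_adj rp_pos.
pose ar x y := arc (rp x y) (rp y x).
have arP x y : adj x y -> graph_path e (pos' x) (pos' y) (ar x y).
  by move=> xy; have := wd_path D (rp_adj _ _ xy); rewrite !rp_pos.
have [es ap _] := wd_plane D.
(* Two distinct points that are ends of both edges determine the edge. *)
have set_pos x y x' y' c c' : adj x y -> adj x' y' -> c != c' ->
    c \in [:: pos' x; pos' y] -> c' \in [:: pos' x; pos' y] ->
    c \in [:: pos' x'; pos' y'] -> c' \in [:: pos' x'; pos' y'] ->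
    [set x'; y'] = [set x; y].
  move=> xy xy' cc; rewrite !inE.
  move=> /orP[]/eqP E1 /orP[]/eqP E2 /orP[]/eqP E3 /orP[]/eqP E4;
    subst c c'; move: cc; rewrite ?E1 ?E2 ?E3 ?E4 ?eqxx // => _;
    by rewrite ?(pos_inj _ _ E3) ?(pos_inj _ _ E4) // setUC.
have set_rp x y x' y' : adj x y -> adj x' y' ->
    [set rp x y; rp y x] = [set rp x' y'; rp y' x'] -> [set x'; y'] = [set x; y].
  move=> xy xy' E; apply: (@set_pos _ _ _ _ (pos' x) (pos' y)) => //.
  - by apply/eqP => /pos_inj xy1; rewrite xy1 adj_irr in xy.
  - by rewrite mem_head.
  - by rewrite !inE eqxx orbT.
  - have : rp x y \in [set rp x' y'; rp y' x'] by rewrite -E !inE eqxx.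
    by rewrite !inE -(rp_pos x y) => /orP[]/eqP->; rewrite !rp_pos eqxx ?orbT.
  have : rp y x \in [set rp x' y'; rp y' x'] by rewrite -E !inE eqxx orbT.
  by rewrite !inE -(rp_pos y x) => /orP[]/eqP->; rewrite !rp_pos eqxx ?orbT.
have disj x y x' y' c : adj x y -> adj x' y' -> c \in ar x y -> c \in ar x' y' ->
    [set x'; y'] = [set x; y] \/ c \in [:: pos' x; pos' y].
  move=> xy xy' c1 c2; case: (wd_disjoint D (rp_adj _ _ xy) (rp_adj _ _ xy') c1 c2).
    by move/(set_rp _ _ _ _ xy xy'); left.
  by rewrite !rp_pos; right.
exists pos', ar; split=> //.
- move=> x y xy; have [p [E pp pu lp]] := arP _ _ xy.
  split; rewrite ?E //.
    case: p E pp pu lp => // _ _ _ /pos_inj xy1; by rewrite xy1 adj_irr in xy.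
  rewrite -E => i j z ij js si sj.
  have jl : (j < size p)%N by move: js; rewrite E.
  have il : (i < size p)%N by apply: ltn_trans jl.
  have U (k l : nat) : (k <= size p)%N -> (l <= size p)%N ->
      ((ar x y)`_k == (ar x y)`_l) = (k == l).
    by move=> hk hl; rewrite E nth_uniq.
  have ei := polyline_path pp il; have ej := polyline_path pp jl; rewrite -E in ei ej.
  case: (ap _ _ _ _ ei ej _ si sj).
  + by case=> /eqP; rewrite U ?(ltnW il) ?(ltnW jl) // => /eqP ij'; rewrite ij' ltnn in ij.
  + case=> /eqP; rewrite U ?(ltnW il) // => /eqP ij' /eqP; rewrite U ?(ltnW jl) // => /eqP ij''.
    by move: ij; rewrite ij'; lia.
  case; rewrite !inE => /orP[]/eqP->; rewrite !U ?(ltnW il) ?(ltnW jl) //.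
    by move/orP=> []/eqP ij'; move: ij; rewrite ij'; lia.
  by move/orP=> []/eqP ij'; [rewrite -ij'|move: ij; rewrite -ltnS ij'; lia].
- by move=> x y xy; rewrite /ar (wd_rev D) ?rp_adj.
move=> x y z xy [i isz zi] zx zy.
have [p [E pp pu lp]] := arP _ _ xy.
have ip : (i < size p)%N by move: isz; rewrite E.
have ei : e (ar x y)`_i (ar x y)`_i.+1 by rewrite E; exact: polyline_path pp ip.
have mi : (ar x y)`_i \in ar x y by rewrite mem_nth // ltnW.
have mi1 : (ar x y)`_i.+1 \in ar x y by rewrite mem_nth.
have zn : z \notin [:: pos' x; pos' y].
  by rewrite !inE negb_or; apply/andP; split; apply/eqP.
have zc : z \in [:: (ar x y)`_i; (ar x y)`_i.+1] -> z \in ar x y.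
  by rewrite !inE => /orP[]/eqP->.
split.
  move=> w zw; have ew := wd_pos D (rp w w); rewrite rp_pos -zw in ew.
  have zz : seg z z z by apply: seg_end; rewrite mem_head.
  have zi' : z \in ar x y.
    apply: zc; case: (ap _ _ _ _ ei ew z zi zz) => [[-> _]|[-> _]|[]] //; exact: mem_head.
  have := @wd_vertex _ _ _ _ _ D _ _ (rp w w) (rp_adj _ _ xy).
  rewrite !rp_pos -zw => /(_ zi').
  by rewrite (negbTE zn).
move=> x' y' xy' [j jsz zj].
have [p' [E' pp' pu' lp']] := arP _ _ xy'.
have jp : (j < size p')%N by move: jsz; rewrite E'.
have ej : e (ar x' y')`_j (ar x' y')`_j.+1 by rewrite E'; exact: polyline_path pp' jp.
have mj : (ar x' y')`_j \in ar x' y' by rewrite mem_nth // ltnW.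
have mj1 : (ar x' y')`_j.+1 \in ar x' y' by rewrite mem_nth.
have nij : (ar x y)`_i != (ar x y)`_i.+1.
  by rewrite E nth_uniq ?ltnS ?(ltnW ip) // neq_ltn ltnSn.
(* If the edges differ, both ends of the segment are ends of both arcs, and [set_pos] applies. *)
have same : (ar x y)`_i \in ar x' y' -> (ar x y)`_i.+1 \in ar x' y' ->
    [set x'; y'] = [set x; y].
  move=> m1 m2.
  case: (disj _ _ _ _ _ xy xy' mi m1) => // h1.
  case: (disj _ _ _ _ _ xy xy' mi1 m2) => // h2.
  case: (disj _ _ _ _ _ xy' xy m1 mi) => // h3.
  case: (disj _ _ _ _ _ xy' xy m2 mi1) => // h4.
  exact: set_pos nij h1 h2 h3 h4.
case: (ap _ _ _ _ ei ej z zi zj) => [[E1 E2]|[E1 E2]|[h1 h2]].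
- by apply: same; rewrite ?E1 ?E2.
- by apply: same; rewrite ?E1 ?E2.
have z2 : z \in ar x' y' by move: h2; rewrite !inE => /orP[]/eqP->.
by case: (disj _ _ _ _ _ xy xy' (zc h1) z2) => //; rewrite (negbTE zn).
Qed.

(* A polyline of [Defs] may repeat its first or its last corner; [shorten] removes
   such repetitions. *)
Definition tidy (s : seq point) : seq point :=
  if s is x :: p then x :: shorten x p else s.

(** The plane graph consists of the segments of all arcs and a loop at each vertex; the arcs become
    paths in it. *)
Lemma planar_weak_drawing (G : sgraph) : planar R G ->
  exists e (pos : G -> point) arc, weak_drawing e pos arc /\ injective pos.
Proof.
case=> pos [arc [pos_inj arcP arcC arcD]].
(* One orientation of each edge is singled out and the other arc defined by reversal, since
   shortening a path need not commute with reversing it. *)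
pose lt (u v : G) := (enum_rank u < enum_rank v)%N.
pose piece (x y : point) :=
  (exists u v i, [/\ adj u v, lt u v, (i.+1 < size (arc u v))%N,
     x = (arc u v)`_i & y = (arc u v)`_i.+1]) \/ exists w, x = pos w /\ y = pos w.
pose e (x y : point) := `[< piece x y \/ piece y x >].
have lt_total u v : adj u v -> lt u v = ~~ lt v u.
  move=> uv; rewrite /lt ltn_neqAle leqNgt andb_idl // => _.
  by apply: contraTneq uv => /ord_inj/enum_rank_inj ->; rewrite adj_irr.
have arcE u v : adj u v -> exists p, arc u v = pos u :: p /\ last (pos u) p = pos v.
  by move=> /arcP []; case: (arc u v) => //= a p _ -> <- _; exists p.
(* A vertex on an arc is one of its two ends, and simplicity then makes it a corner of every segment
   through it. *)
have end_of u v i w : adj u v -> (i.+1 < size (arc u v))%N ->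
    seg (arc u v)`_i (arc u v)`_i.+1 (pos w) ->
    pos w \in [:: (arc u v)`_i; (arc u v)`_i.+1].
  move=> uv si sw; have [p [E lp]] := arcE u v uv; have [_ _ _ simple] := arcP _ _ uv.
  have s0 : (1 < size (arc u v))%N by apply: leq_trans si.
  have [wu|/eqP wu] := eqVneq (pos w) (pos u).
    case: i si sw => [|i] si sw; first by rewrite E wu mem_head.
    have [|[->] Ew] := simple 0 i.+1 (pos w) (ltn0Sn _) si _ sw; last by rewrite Ew mem_head.
    by apply: seg_end; rewrite wu E mem_head.
  have [wv|/eqP wv] := eqVneq (pos w) (pos v).
    pose k := (size p).-1.
    have sk : (k.+1 < size (arc u v))%N by move: s0; rewrite /k E /=; case: (size p).
    have Ev : pos v = (arc u v)`_k.+1.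
      rewrite -lp E (last_nth 0) /k prednK //; by move: s0; rewrite E.
    have [ik|ki|->] := ltngtP i k; last by rewrite wv Ev !inE eqxx orbT.
      have [|Ek Ew] := simple i k (pos w) ik sk sw.
        by apply: seg_end; rewrite wv Ev !inE eqxx orbT.
      by rewrite Ew Ek !inE eqxx orbT.
    by move: si ki; rewrite /k E /=; lia.
  have [|/(_ w)] := arcD u v (pos w) uv _ wu wv; first by exists i.
  by [].
have piece_end x y w : piece x y -> seg x y (pos w) -> pos w \in [:: x; y].
  case=> [[u [v [i [uv _ si -> ->]]]]|[w' [-> ->]]]; first exact: end_of.
  by case=> t _ ->; rewrite -scalerDl subrK scale1r mem_head.
have loop_vertex x w : seg (pos w) (pos w) x -> exists w, x = pos w.
  by case=> t _ ->; exists w; rewrite -scalerDl subrK scale1r.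
have piece_apart x y x' y' : piece x y -> piece x' y' -> segs_apart x y x' y'.
  move=> h h' p hp hp'; have [[w pw]|nw] := pselect (exists w, p = pos w).
    by subst p; apply: Or33; split; apply: piece_end.
  case: h hp => [[u [v [i [uv luv si -> ->]]]] hp|[w [-> ->]] /loop_vertex //].
  case: h' hp' => [[u' [v' [j [uv' luv' sj -> ->]]]] hp'|[w [-> ->]] /loop_vertex //].
  have pn w : p <> pos w by move=> pw; apply: nw; exists w.
  have [_ /(_ u' v' uv') E] := arcD u v p uv (ex_intro2 _ _ i si hp) (pn u) (pn v).
  have {}E := E (ex_intro2 _ _ j sj hp').
  have [Eu Ev] : u' = u /\ v' = v.
    have uv2 : u != v by apply: contraTneq uv => ->; rewrite adj_irr.
    move/setP: E => E; have := E u; have := E v; rewrite !inE !eqxx orbT /=.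
    move=> /orP[]/eqP E1 /orP[]/eqP E2; rewrite -?E1 -?E2 //.
    - by rewrite E1 E2 eqxx in uv2.
    - by move: luv'; rewrite -E1 -E2 lt_total 1?adj_sym // luv.
    by rewrite E1 E2 eqxx in uv2.
  subst u' v'; have [_ _ _ simple] := arcP _ _ uv.
  have [ij|ji|->] := ltngtP i j; last exact: Or31.
    have [Ej Ep] := simple i j p ij sj hp hp'.
    by apply: Or33; rewrite Ep !inE -?Ej !eqxx ?orbT.
  have [Ej Ep] := simple j i p ji si hp' hp.
  by apply: Or33; rewrite Ep !inE -?Ej !eqxx ?orbT.
have memS : exists S : seq point, forall x y, e x y -> x \in S.
  exists (flatten [seq arc u v | u <- enum G, v <- enum G] ++ [seq pos w | w <- enum G]).
  have arcS u v x : x \in arc u v -> x \in flatten [seq arc u v | u <- enum G, v <- enum G].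
    by move=> xi; apply/flattenP; exists (arc u v) => //; apply: allpairs_f; rewrite mem_enum.
  have posS w : pos w \in [seq pos w | w <- enum G] by apply: map_f; rewrite mem_enum.
  move=> x y /asboolP [] [[u [v [i [uv _ si xE yE]]]]|[w [xE yE]]]; rewrite mem_cat.
  - by rewrite xE (arcS u v) // mem_nth // ltnW.
  - by rewrite xE posS orbT.
  - by rewrite yE (arcS u v) // mem_nth.
  - by rewrite yE posS orbT.
have es : symmetric e by move=> x y; apply: asbool_equiv_eq; split=> -[]; auto.
have pathe u v p : adj u v -> lt u v -> arc u v = pos u :: p -> path e (pos u) p.
  move=> uv l E; apply/(pathP 0) => i ip; apply/asboolP; left; left.
  by exists u, v, i; rewrite E /=; split.
pose ar u v := if lt u v then tidy (arc u v) else rev (tidy (arc v u)).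
have ar_rev u v : adj u v -> ar v u = rev (ar u v).
  by move=> uv; rewrite /ar (lt_total u v) //; case: (lt v u) => //=; rewrite revK.
have ar_path u v : adj u v -> lt u v -> graph_path e (pos u) (pos v) (ar u v) /\
    {subset ar u v <= arc u v}.
  move=> uv l; have [p [E lp]] := arcE u v uv.
  rewrite /ar l E /tidy -lp; case/shortenP: (pathe u v p uv l E) => p' h1 h2 h3.
  split; first by exists p'.
  by move=> x; rewrite !inE => /orP[->|/h3->]; rewrite ?orbT.
have ar_sub u v : adj u v -> {subset ar u v <= arc u v}.
  move=> uv; have [/(ar_path u v uv) []//|l] := boolP (lt u v).
  have vu : adj v u by rewrite adj_sym.
  have [_ h] := ar_path v u vu (etrans (lt_total v u vu) l).
  by move=> x; rewrite (ar_rev v u vu) (arcC v u vu) !mem_rev; apply: h.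
have on_ar u v x : adj u v -> x \in ar u v -> on_polyline (arc u v) x.
  by move=> uv /(ar_sub u v uv); apply: mem_polyline; have [] := arcP _ _ uv.
exists e, pos, ar; split=> //; split=> //.
- split=> // x y x' y' /asboolP h /asboolP h'.
  case: h => h; case: h' => h'.
  + exact: piece_apart.
  + exact/segs_apartC/segs_apart_swap/segs_apartC/piece_apart.
  + exact/segs_apart_swap/piece_apart.
  + exact/segs_apart_swap/segs_apartC/segs_apart_swap/segs_apartC/piece_apart.
- by move=> w; apply/asboolP; left; right; exists w.
- move=> u v uv; have [/(ar_path u v uv) []//|l] := boolP (lt u v).
  have vu : adj v u by rewrite adj_sym.
  have [h _] := ar_path v u vu (etrans (lt_total v u vu) l).
  by rewrite (ar_rev v u vu); apply: graph_path_rev.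
- move=> u v w uv /(on_ar u v _ uv) h; apply/negPn/negP.
  rewrite !inE negb_or => /andP[/eqP wu /eqP wv].
  by have [/(_ w)] := arcD u v (pos w) uv h wu wv.
move=> u v u' v' c uv uv' /(on_ar u v _ uv) h /(on_ar u' v' _ uv') h'.
have [|] := boolP (c \in [:: pos u; pos v]); first by right.
rewrite !inE negb_or => /andP[/eqP cu /eqP cv]; left.
by have [_ /(_ u' v' uv' h') ->] := arcD u v c uv h cu cv.
Qed.

Lemma planar_contract (G : sgraph) (u v : G) : adj u v -> planar R G ->
  planar R (contract u v).
Proof.
move=> uv /planar_weak_drawing [e [pos [arc [D pos_inj]]]].
have [e' [pos' [arc' [D' puv pi]]]] := pull_edge D pos_inj uv.
(* An edge at the new vertex is drawn by the arc from [u] if there is one, and from [v] otherwise.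
   The value for [None], [None] only has to sit at the right point. *)
pose rp (x y : contract u v) : G :=
  match x, y with
  | Some x, _ => val x
  | None, Some y => if adj u (val y) then u else v
  | None, None => u
  end.
pose ps (x : contract u v) := if x is Some x then pos' (val x) else pos' u.
have nu : v \in predC1 u by rewrite inE eq_sym (adj_neq uv).
apply: (@weak_drawing_planar _ _ _ _ _ ps rp D').
- have N (x : {x : G | (x != u) && (x != v)}) : pos' (val x) <> pos' u.
    have /andP[xu xv] := valP x; rewrite puv => /pi /=.
    by rewrite inE xu nu => /(_ isT isT) E; case/eqP: xv.
  move=> [x|] [y|] //= E.
  + have /andP[xu _] := valP x; have /andP[yu _] := valP y.
    by congr Some; apply: val_inj; apply: pi E; rewrite inE.
  + by case: (N _ E).
  + by case: (N _ (esym E)).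
- move=> [x|] [y|] //=.
    by case: ifP => [h _|_ h]; rewrite adj_sym.
  by case: ifP => [h _|_ h] //.
by move=> [x|] [y|] //=; case: ifP.
Qed.
End PlanarContract.

(** * Containment relations and Ramsey's theorem *)

Section Containment.

Lemma planar_embed (R : realType) (K G : sgraph) (f : K -> G) : injective f ->
  (forall x y, adj x y -> adj (f x) (f y)) -> planar R G -> planar R K.
Proof.
move=> f_inj f_adj [pos [arc [pos_inj arcP arcC arcD]]].
exists (pos \o f), (fun x y => arc (f x) (f y)); split=> /=.
- exact: inj_comp.
- by move=> u v uv; apply/arcP/f_adj.
- by move=> u v uv; apply/arcC/f_adj.
move=> u v x uv xuv xu xv; have [h1 h2] := arcD _ _ x (f_adj _ _ uv) xuv xu xv.
split=> [w|u' v' uv' xuv']; first exact: h1.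
by apply: (imset_inj f_inj); rewrite !imsetU1 !imset_set1; apply: h2; first exact: f_adj.
Qed.

Lemma independence_number_embed (K G : sgraph) (f : K -> G) : injective f ->
  (forall x y, adj (f x) (f y) -> adj x y) ->
  independence_number K <= independence_number G.
Proof.
move=> f_inj f_adj; apply/bigmax_leqP => S /forall_inP stS.
rewrite -(card_imset _ f_inj); apply: leq_bigmax_cond.
apply/forall_inP => _ /imsetP[x xS ->]; apply/forall_inP => _ /imsetP[y yS ->].
by apply: contra (f_adj x y) _; move/forall_inP: (stS x xS); apply.
Qed.

(** A dissolution contracts an edge, so closure under deletion and contraction covers all three
    operations. *)
Lemma op_step_contract o G G' : op_step o G G' ->
  (exists v : G, G' = del_vertex v) \/
  exists u v : G, adj u v /\ G' = contract u v.
Proof.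
case=> {G G'} [G v|G u v uv|G v u w uw E uw']; first by left; exists v.
  by right; exists u, v.
right; exists v, u; split=> //.
by have /setP/(_ u) := E; rewrite !inE eqxx.
Qed.

Lemma planar_obtained (R : realType) ops G H :
  obtained ops G H -> planar R G -> planar R H.
Proof.
elim=> {G H} [G H [f [g fK gK] f_adj]|o G G' H _ st _ IH] pG.
  apply: (planar_embed (can_inj gK)) pG => x y xy.
  by rewrite -f_adj !gK.
apply: IH; case: (op_step_contract st) => [[v ->]|[u [v [uv ->]]]].
  exact: (@planar_embed R (del_vertex v) G val val_inj).
exact: planar_contract.
Qed.

Lemma independence_number_obtained ops G H :
  obtained ops G H -> independence_number H <= independence_number G.
Proof.
elim=> {G H} [G H [f [g fK gK] f_adj]|o G G' H _ st _ IH].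
  apply: (independence_number_embed (can_inj gK)) => x y.
  by rewrite -f_adj !gK.
apply: leq_trans IH _; case: (op_step_contract st) => [[v ->]|[u [v [uv ->]]]].
  exact: (@independence_number_embed (del_vertex v) G val val_inj).
(* Sending the new vertex to [u] reflects adjacency, because the new vertex has all neighbours of
   [u] outside the edge. *)
pose f (x : contract u v) : G := if x is Some x then val x else u.
apply: (@independence_number_embed _ _ f).
  have fu (x : {x : G | (x != u) && (x != v)}) : val x <> u.
    by move=> E; have := valP x; rewrite E eqxx.
  move=> [x|] [y|] //= E; first by congr Some; apply: val_inj.
    by case: (fu x E).
  by case: (fu y (esym E)).
move=> [x|] [y|] //=; first by rewrite adj_sym => ->.
  by move=> ->.
by rewrite adj_irr.
Qed.

Lemma independence_number_edgeless s : independence_number (edgeless s) = s.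
Proof.
apply/eqP; rewrite eqn_leq; apply/andP; split.
  by apply/bigmax_leqP => S _; rewrite -[X in _ <= X]card_ord max_card.
rewrite -[X in X <= _]card_ord -cardsT; apply: leq_bigmax_cond.
by apply/forall_inP => x _; apply/forall_inP.
Qed.

End Containment.

Section Ramsey.

Definition clique (G : sgraph) (K : {set G}) :=
  {in K &, forall x y, x != y -> adj x y}.

Lemma ramsey k s : exists N : nat, forall (G : sgraph) (A : {set G}), N <= #|A| ->
  (exists K : {set G}, [/\ K \subset A, #|K| = k & clique K]) \/
  (exists S : {set G}, [/\ S \subset A, #|S| = s & stable S]).
Proof.
elim: k s => [|k IHk] s.
  exists 0 => G A _; left; exists set0; rewrite sub0set cards0; split=> //.
  by move=> x y; rewrite inE.
elim: s => [|s [N2 IHs]].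
  exists 0 => G A _; right; exists set0; rewrite sub0set cards0; split=> //.
  by apply/forall_inP => x; rewrite inE.
(* The usual recursion: beside [x], the set has [N1] neighbours or [N2] non-neighbours of [x]. *)
have [N1 IH1] := IHk s.+1; exists (N1 + N2).+1 => G A NA.
have /card_gt0P[x xA] : 0 < #|A| by apply: leq_trans NA.
pose B := A :&: [set y | adj x y]; pose C := (A :\ x) :\: [set y | adj x y].
have cA : #|A| = (#|B| + #|C|).+1.
  rewrite (cardsD1 x) xA add1n -(cardsID [set y | adj x y] (A :\ x)); congr (_ + _).+1.
  apply: eq_card => y; rewrite !inE; case: eqP => //= ->.
  by rewrite adj_irr andbF.
have [NB|NC] : N1 <= #|B| \/ N2 <= #|C| by lia.
- have [[K [KB cK qK]]|[S [SB cS stS]]] := IH1 G B NB.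
    left; exists (x |: K).
    have xK y : y \in K -> adj x y by move=> /(subsetP KB); rewrite !inE => /andP[].
    have xnK : x \notin K by apply/negP => /xK; rewrite adj_irr.
    rewrite cardsU1 cK xnK; split=> //.
      rewrite subUset sub1set xA; apply: subset_trans KB _; exact: subsetIl.
    move=> y z; rewrite !inE => /orP[/eqP->|yK] /orP[/eqP->|zK] yz.
    + by rewrite eqxx in yz.
    + exact: xK.
    + by rewrite adj_sym xK.
    + exact: qK.
  right; exists S; split=> //; apply: subset_trans SB _; exact: subsetIl.
have [[K [KC cK qK]]|[S [SC cS stS]]] := IHs G C NC.
  left; exists K; split=> //; apply: subset_trans KC _.
  by apply: subset_trans (subsetDl _ _) (subsetDl _ _).
right; exists (x |: S).
have xS y : y \in S -> ~~ adj x y /\ y != x.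
  by move=> /(subsetP SC); rewrite !inE => /and3P[].
have xnS : x \notin S by apply/negP => /xS[_]; rewrite eqxx.
rewrite cardsU1 cS xnS; split=> //.
  rewrite subUset sub1set xA; apply: subset_trans SC _.
  by apply: subset_trans (subsetDl _ _) (subsetDl _ _).
apply/forall_inP => y yS; apply/forall_inP => z zS.
move: yS zS; rewrite !inE => /orP[/eqP->|yS] /orP[/eqP->|zS].
- by rewrite adj_irr.
- by have [] := xS z zS.
- by rewrite adj_sym; have [] := xS y yS.
by move/forall_inP: stS => /(_ y yS)/forall_inP; apply.
Qed.

Lemma finite_bounded_order N : finite_up_to_iso (fun H => #|H| < N).
Proof.
pose T : finType := {n : 'I_N & {ffun 'I_n * 'I_n -> bool}}.
(* Symmetrising and removing the diagonal turns every boolean matrix into a graph, so all matrices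
   can be enumerated. *)
pose rl (t : T) (x y : 'I_(tag t)) := (x != y) && (tagged t (x, y) || tagged t (y, x)).
have rl_sym t : symmetric (@rl t) by move=> x y; rewrite /rl eq_sym orbC.
have rl_irr t : irreflexive (@rl t) by move=> x; rewrite /rl eqxx.
pose gr t := SGraph (rl_sym t) (rl_irr t).
exists #|T|, (fun i => gr (enum_val i)) => H HN.
pose t : T := existT _ (Ordinal HN)
  [ffun p : 'I_#|H| * 'I_#|H| => adj (enum_val p.1) (enum_val p.2)].
suff iso : isomorphic H (gr t) by exists (enum_rank t); rewrite enum_rankK.
exists (@enum_rank H : H -> gr t).
  by exists (@enum_val H H); [exact: enum_rankK|exact: enum_valK].
move=> x y; rewrite /= /rl /= !ffunE /= !enum_rankK (adj_sym y x) orbb.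
rewrite (inj_eq enum_rank_inj).
by case: eqP => [->|//]; rewrite adj_irr.
Qed.

Lemma finite_planar_bounded_independence (R : realType) c :
  finite_up_to_iso (fun H => planar R H /\ independence_number H <= c).
Proof.
have [N NP] := ramsey 5 c.+1.
have [k [F FP]] := finite_bounded_order N.
exists k, F => H [pH aH]; apply: FP; rewrite ltnNge; apply/negP => NH.
rewrite -cardsT in NH; have [[K [_ cK qK]]|[S [_ cS stS]]] := NP H [set: H] NH.
  pose f (i : 'I_5) : H := enum_val (cast_ord (esym cK) i).
  have f_inj : injective f by move=> i j /enum_val_inj/cast_ord_inj.
  apply: (@planar_no_K5 R H f f_inj _ pH) => i j ij.
  by apply: qK; rewrite ?enum_valP // (inj_eq f_inj).
have : #|S| <= independence_number H by apply: leq_bigmax_cond.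
by rewrite cS ltnNge aH.
Qed.

End Ramsey.

(** * NP-completeness on classes that exclude a graph *)

Lemma NP_complete_on_sub (Pi : problem) (C C' : graph_class) :
  (forall G, C G -> C' G) -> NP_complete_on Pi C -> NP_complete_on Pi C'.
Proof.
(* Membership in NP concerns [Pi] alone, and the reductions into [C] also land in [C']. *)
move=> CC' [inNP hard]; split=> // L /hard[f pf fP]; exists f => // w.
by have [I [? ? ?]] := fP w; exists I; split=> //; apply: CC'.
Qed.

Theorem theorem2 (R : realType) (Pi : problem) (hPi : C46_problem R Pi) :
  exists open_case : graph_class,
    [/\ finite_up_to_iso open_case,
        forall H : sgraph, ~ open_case H ->
          [/\ NP_complete_on Pi (induced_subgraph_free H),
              NP_complete_on Pi (contraction_free H),
              NP_complete_on Pi (induced_minor_free H) &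
              NP_complete_on Pi (induced_topological_minor_free H)] &
        exists2 s : nat, 1 <= s &
          forall H : sgraph, open_case H -> 
            planar R H /\ induced_subgraph_free (edgeless s) H].
Proof.
case: hPi => hplanar [C [c Cc] hC].
exists (fun H => planar R H /\ independence_number H <= c); split.
- exact: finite_planar_bounded_independence.
- move=> H nopen.
  (* All four containments are instances of [obtained], so one class that avoids [H] under any
     operations settles the four claims. *)
  suff [D [hD D_free]] : exists D : graph_class, NP_complete_on Pi D /\
      forall ops G, D G -> ~ obtained ops G H.
    by split; apply: NP_complete_on_sub hD => G DG; apply: D_free.
  have [pH|npH] := pselect (planar R H); last first.
    exists (planar R); split=> // ops G pG GH; exact: npH (planar_obtained GH pG).
  exists C; split=> // ops G CG /independence_number_obtained GH.
  by apply: nopen; split=> //; apply: leq_trans GH (Cc G CG).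
(* The graph [edgeless c.+1] has independence number [c.+1], too large to be contained in an open
   case. *)
exists c.+1 => // H [pH aH]; split=> // /independence_number_obtained.
by rewrite independence_number_edgeless ltnNge aH.
Qed.
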